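(* Let $p$ be a prime and let $\mathcal{F}$ be a saturated fusion system over a finite $p$-group $P$. Then $\mathcal{F}=\mathcal{F}_P(P)$ if and only if $N_{\mathcal{F}}(P)=\mathcal{F}_P(P)$ and $\Phi(P)$ is an $\mathcal{F}$-strongly closed subgroup.
   Context: All groups are finite. Saturated fusion systems over a finite $p$-group are understood in the standard (Puig / Broto–Levi–Oliver / Aschbacher–Kessar–Oliver) sense. $\mathcal{F}_P(P)$ denotes the fusion system over $P$ whose morphisms are exactly the homomorphisms between subgroups of $P$ induced by conjugation by elements of $P$. $\Phi(P)$ denotes the Frattini subgroup of $P$. A subgroup $Q\le P$ is $\mathcal{F}$-strongly closed (in $P$) if no element of $Q$ is $\mathcal{F}$-conjugate to an element of $P\setminus Q$; that is, for every $x\in Q$ and every morphism $\varphi:\langle x\rangle\to P$ in $\mathcal{F}$ one has $\varphi(x)\in Q$. $N_{\mathcal{F}}(P)$ is the fusion system over $P$ whose morphisms $R\to S$ (for $R,S\le P$) are the morphisms $\varphi:R\to S$ of $\mathcal{F}$ that extend to an $\mathcal{F}$-automorphism of $P$, i.e. for which there is $\hat\varphi\in\mathrm{Aut}_{\mathcal{F}}(P)$ with $\hat\varphi|_R=\varphi$. *)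

(* Defs.v *)
From mathcomp Require Import all_boot all_fingroup all_solvable.

Set Implicit Arguments.
Unset Strict Implicit.
Unset Printing Implicit Defensive.

Local Open Scope group_scope.

(* A morphism R -> S is represented by a function f : gT -> gT of which only  *)
(* the restriction to R is relevant; fhom_ext below makes membership in a     *)
(* fusion system insensitive to the values of f outside R.                    *)

Section FusionSystem.

Variable gT : finGroupType.
Implicit Types (R S T Q : {group gT}) (f g : gT -> gT).

Definition hom_sets := {group gT} -> {group gT} -> pred (gT -> gT).

(* f is an isomorphism from R to S in the category with morphisms H. *)
Definition cat_iso (H : hom_sets) R S f : Prop :=
  H R S f /\
  exists g, [/\ H S R g, {in R, cancel f g} & {in S, cancel g f}].

(* In fhom_factor, the inclusion T -> S is the identity function, so that the *)
(* composite of f : R -> T with it is again f.  Identities and inclusions are *)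
(* obtained from fhom_conj with a = 1.                                        *)
Record fusion_system (P : {group gT}) := FusionSystem {
  fhom :> {group gT} -> {group gT} -> pred (gT -> gT);
  fhom_ext : forall R S f g, {in R, f =1 g} -> fhom R S f = fhom R S g;
  fhom_obj : forall R S f, fhom R S f -> R \subset P /\ S \subset P;
  fhom_inj : forall R S f, fhom R S f ->
    [/\ morphic R f, {in R &, injective f} & f @: R \subset S];
  fhom_comp : forall R S T f g, fhom R S f -> fhom S T g -> fhom R T (g \o f);
  fhom_conj : forall R S a, R \subset P -> S \subset P -> a \in P ->
    R :^ a \subset S -> fhom R S (conjg^~ a);
  fhom_factor : forall R S f, fhom R S f ->
    exists2 T : {group gT}, T \subset S & cat_iso fhom R T f
}.

Definition fusion_eq P (F G : fusion_system P) : Prop :=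
  forall R S f, F R S f = G R S f.

Section Saturation.

Variables (P : {group gT}) (F : fusion_system P).

Lemma fhom_id R S : R \subset S -> S \subset P -> F R S id.
Proof.
move=> sRS sSP; rewrite (@fhom_ext _ F R S id (conjg^~ 1)); last first.
  by move=> x _; rewrite conjg1.
by apply: fhom_conj => //; [apply: subset_trans sSP | rewrite conjsg1].
Qed.

Definition AutF R : {set {perm gT}} := [set a in Aut R | F R R a].

Lemma AutF_group_set R : R \subset P -> group_set (AutF R).
Proof.
move=> sRP; apply/group_setP; split=> [|a b].
  apply/setIdP; split; first exact: group1.
  by rewrite (@fhom_ext _ F R R _ id) ?fhom_id // => x _; rewrite perm1.
case/setIdP=> Aa Fa /setIdP[Ab Fb]; apply/setIdP; split; first exact: groupM.
rewrite (@fhom_ext _ F R R _ (b \o a)); first exact: fhom_comp Fa Fb.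
by move=> x _; rewrite permM.
Qed.

Definition AutP R : {set {perm gT}} := conj_aut R @* 'N_P(R).

Definition fconj R S : Prop := exists f, cat_iso (fhom F) R S f.

Definition fully_normalized R : Prop :=
  forall S, fconj R S -> #|'N_P(S)| <= #|'N_P(R)|.

Definition fully_centralized R : Prop :=
  forall S, fconj R S -> #|'C_P(S)| <= #|'C_P(R)|.

(* The set N_f of the a in N_P(R) such that f o c_a o f^-1 is in Aut_P(f R).  *)
Definition Nphi R f : {set gT} :=
  [set a in 'N_P(R) | [exists b in 'N_P(f @: R),
                         [forall x in R, f (x ^ a) == f x ^ b]]].

Lemma Nphi_group_set R f : group_set (Nphi R f).
Proof.
apply/group_setP; split=> [|a b].
  apply/setIdP; split; first exact: group1.
  apply/exists_inP; exists 1; first exact: group1.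
  by apply/forall_inP=> x _; rewrite !conjg1.
case/setIdP=> Na /exists_inP[c Nc /forall_inP fac].
case/setIdP=> Nb /exists_inP[d Nd /forall_inP fbd].
apply/setIdP; split; first exact: groupM.
apply/exists_inP; exists (c * d); first exact: groupM.
apply/forall_inP=> x Rx; rewrite !conjgM -(eqP (fac x Rx)).
by apply: fbd; rewrite memJ_norm //; case/setIP: Na.
Qed.

Canonical Nphi_group R f : {group gT} := Group (Nphi_group_set R f).

(* The saturation axioms of Broto, Levi and Oliver. *)
Definition saturated (p : nat) : Prop :=
  (forall R, R \subset P -> fully_normalized R ->
     fully_centralized R /\ p.-Sylow(AutF R) (AutP R)) /\
  (forall R Q f, F R P f -> f @: R = Q -> fully_centralized Q ->
     exists2 g, F (Nphi_group R f) P g & {in R, g =1 f}).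

Definition strongly_closed Q : Prop :=
  Q \subset P /\ forall x f, x \in Q -> F <[x]>%G P f -> f x \in Q.

End Saturation.

Section InnerFusion.

Variable P : {group gT}.

Definition inner_hom : hom_sets := fun R S f =>
  [&& R \subset P, S \subset P, f @: R \subset S
    & [exists a in P, [forall x in R, f x == x ^ a]]].

Lemma inner_homP R S f :
  reflect ([/\ R \subset P, S \subset P, f @: R \subset S
             & exists2 a, a \in P & {in R, forall x, f x = x ^ a}])
          (inner_hom R S f).
Proof.
apply: (iffP and4P) => [] [sRP sSP sfRS].
  by case/exists_inP=> a Pa /eqfun_inP fa; split=> //; exists a.
by case=> a Pa fa; split=> //; apply/exists_inP; exists a => //; apply/eqfun_inP.
Qed.

Let inner_ext R S f g : {in R, f =1 g} -> inner_hom R S f = inner_hom R S g.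
Proof.
move=> eqfg; rewrite /inner_hom (eq_in_imset eqfg); do 3![congr (_ && _)].
by apply: eq_existsb => a; congr (_ && _); apply: eq_forallb_in => x /eqfg->.
Qed.

Let inner_obj R S f : inner_hom R S f -> R \subset P /\ S \subset P.
Proof. by case/inner_homP. Qed.

Let inner_inj R S f : inner_hom R S f ->
  [/\ morphic R f, {in R &, injective f} & f @: R \subset S].
Proof.
case/inner_homP=> _ _ sfRS [a Pa fa]; split=> // [|x y Rx Ry].
  by apply/morphicP=> x y Rx Ry; rewrite !fa ?groupM // conjMg.
by rewrite !fa //; apply: conjg_inj.
Qed.

Let inner_comp R S T f g :
  inner_hom R S f -> inner_hom S T g -> inner_hom R T (g \o f).
Proof.
case/inner_homP=> sRP _ sfRS [a Pa fa] /inner_homP[_ sTP sgST [b Pb gb]].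
have Sf x : x \in R -> f x \in S by move=> Rx; apply/(subsetP sfRS)/imset_f.
apply/inner_homP; split=> //.
  by apply/subsetP=> _ /imsetP[x Rx ->]; apply/(subsetP sgST)/imset_f/Sf.
by exists (a * b) => [|x Rx /=]; rewrite ?groupM // gb ?Sf // fa // conjgM.
Qed.

Let inner_conj R S a : R \subset P -> S \subset P -> a \in P ->
  R :^ a \subset S -> inner_hom R S (conjg^~ a).
Proof. by move=> sRP sSP Pa sRaS; apply/inner_homP; split=> //; exists a. Qed.

Let inner_factor R S f : inner_hom R S f ->
  exists2 T : {group gT}, T \subset S & cat_iso inner_hom R T f.
Proof.
case/inner_homP=> sRP sSP sfRS [a Pa fa].
have fR : f @: R = R :^ a by apply: eq_in_imset => x /fa.
have sRaS : R :^ a \subset S by rewrite -fR.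
have sRaP := subset_trans sRaS sSP.
exists (R :^ a)%G => //; split.
  by apply/inner_homP; split; rewrite ?fR //; exists a.
exists (conjg^~ a^-1); split=> [|x Rx|_ /imsetP[x Rx ->]].
- by apply: inner_conj; rewrite ?groupV //= conjsgK.
- by rewrite fa // conjgK.
by rewrite conjgK fa.
Qed.

Definition inner_fusion : fusion_system P :=
  FusionSystem inner_ext inner_obj inner_inj inner_comp inner_conj inner_factor.

End InnerFusion.

Section NormalizerFusion.

Variables (P : {group gT}) (F : fusion_system P).

Definition norm_hom : hom_sets := fun R S f =>
  F R S f && [exists a in AutF F P, [forall x in R, f x == a x]].

Lemma norm_homP R S f :
  reflect (F R S f /\ exists2 a, a \in AutF F P & {in R, f =1 a})
          (norm_hom R S f).
Proof.
apply: (iffP andP) => [] [Ff].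
  by case/exists_inP=> a Aa /eqfun_inP fa; split=> //; exists a.
by case=> a Aa fa; split=> //; apply/exists_inP; exists a => //; apply/eqfun_inP.
Qed.

Let norm_ext R S f g : {in R, f =1 g} -> norm_hom R S f = norm_hom R S g.
Proof.
move=> eqfg; rewrite /norm_hom (fhom_ext F S eqfg); congr (_ && _).
by apply: eq_existsb => a; congr (_ && _); apply: eq_forallb_in => x /eqfg->.
Qed.

Let norm_obj R S f : norm_hom R S f -> R \subset P /\ S \subset P.
Proof. by case/norm_homP=> /fhom_obj. Qed.

Let norm_inj R S f : norm_hom R S f ->
  [/\ morphic R f, {in R &, injective f} & f @: R \subset S].
Proof. by case/norm_homP=> /fhom_inj. Qed.

Let norm_comp R S T f g :
  norm_hom R S f -> norm_hom S T g -> norm_hom R T (g \o f).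
Proof.
case/norm_homP=> Ff [a Aa fa] /norm_homP[Fg [b Ab gb]].
apply/norm_homP; split; first exact: fhom_comp Ff Fg.
have /group_setP[_ AM] := AutF_group_set F (subxx P).
exists (a * b); first exact: AM.
move=> x Rx /=; rewrite permM -fa // gb //.
by have [_ _ /subsetP->] := fhom_inj Ff; rewrite ?imset_f.
Qed.

Let norm_conj R S a : R \subset P -> S \subset P -> a \in P ->
  R :^ a \subset S -> norm_hom R S (conjg^~ a).
Proof.
move=> sRP sSP Pa sRaS; apply/norm_homP; split; first exact: fhom_conj.
have eqa : {in P, conjg^~ a =1 conj_aut P a}.
  by move=> x Px; rewrite /= conj_autE.
exists (conj_aut P a); last by move=> x /(subsetP sRP)/eqa.
rewrite inE Aut_aut -(fhom_ext F P eqa).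
by apply: fhom_conj; rewrite ?conjGid.
Qed.

Let norm_factor R S f : norm_hom R S f ->
  exists2 T : {group gT}, T \subset S & cat_iso norm_hom R T f.
Proof.
case/norm_homP=> Ff [a Aa fa].
have [T sTS [FfT [g [Fg fK gK]]]] := fhom_factor Ff.
exists T => //; split; first by apply/norm_homP; split=> //; exists a.
exists g; split=> //; apply/norm_homP; split=> //.
exists a^-1; first by rewrite (groupV (Group (AutF_group_set F (subxx P)))).
move=> y Ty; have Rgy : g y \in R.
  by have [_ _ /subsetP->] := fhom_inj Fg; rewrite ?imset_f.
by apply: (canRL (permK a)); rewrite -fa // gK.
Qed.

Definition norm_fusion : fusion_system P :=
  FusionSystem norm_ext norm_obj norm_inj norm_comp norm_conj norm_factor.

End NormalizerFusion.

End FusionSystem.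

(* Main.v *)
Require Import Defs.
From mathcomp Require Import all_boot all_order all_fingroup all_algebra all_solvable.

(* For the nontrivial direction, say that F is inner modulo a normal subgroup *)
(* Q of P if every morphism f of F agrees modulo Q with conjugation by some   *)
(* element of P.  Alperin's fusion theorem and a Frattini argument in Aut_F(R)*)
(* show that F is inner modulo Phi(P).  One then descends: if F is inner      *)
(* modulo Q with 1 <> Q <= Phi(P), choose D < Q normal in P of index p and a  *)
(* P-invariant lam : Q -> F_p with kernel D.  Once lam is F-invariant,        *)
(* p'-automorphisms act trivially modulo D, so F is inner modulo D.           *)
(*                                                                            *)
(* The F-invariance of lam is a transfer argument in the spirit of Tate.  For *)
(* a morphism f on R the map lam o f - lam on R :&: Q is the restriction of a *)
(* homomorphism R -> F_p.  Consider formal integral combinations of orbits    *)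
(* R \ P decorated with functions lam + k on R :&: Q, k in Hom(R, F_p).       *)
(* Starting from the one-point orbit decorated with lam, proper orbits can be *)
(* added so that the numbers of fixed points with prescribed decoration become*)
(* F-invariant (as in the Broto-Levi-Oliver construction of bisets).  The     *)
(* transfer of the decorations to Q is then F-invariant as well; but it is    *)
(* lam times a number congruent to 1 mod p, because the transfers of the k    *)
(* are homomorphisms P -> F_p and hence vanish on Phi(P).                     *)

Set Implicit Arguments.
Unset Strict Implicit.
Unset Printing Implicit Defensive.

Import GRing.Theory FinRing.Theory.
Local Open Scope group_scope.

(** * Isomorphisms of a fusion system and their extensions *)

(** Only the converse has content. Its hypothesis on [norm_fusion F] makes every F-automorphism of P
    inner. Morphisms are then compared with conjugations modulo a descending chain of normal
    subgroups Q of P, from Phi(P) to 1; modulo 1 the comparison is equality. At each stage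
    [alperin_inner_mod] reduces it to automorphisms of fully normalized subgroups R.

    Start ([Phi_inner_mod]): Aut_P(R) acts trivially modulo Phi(P), so a Frattini argument writes
    each automorphism of R as one trivial modulo Phi(P) followed by one normalising Aut_P(R). By
    saturation the latter extends to N_P(R), where induction applies.

    Descent ([inner_mod_smaller]): a quotient Q/D of order p is central in P/D and gives lam : Q ->
    F_p. Once lam is F-invariant ([lam_stable]), p'-automorphisms of R are trivial modulo D, and the
    Sylow subgroup Aut_P(R) accounts for the rest of Aut_F(R) ([sylow_inner_mod]).

    Invariance of lam: [exists_stable] provides a virtual decorated P-set of degree 1 modulo p with
    F-stable marks. By [mark_sum_eval] a fixed integral combination of its marks at the groups
    <q^(p^i)> equals p^N z with z = lam q modulo p. The marks do not change when q is replaced by f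
    q, so neither does z. The homomorphisms by which decorations differ from lam enter z only
    through their transfers, which vanish on Phi(P) ([transfer_Phi_Fp]). *)

Section Fusion.

Variables (gT : finGroupType) (P : {group gT}) (F : fusion_system P).
Implicit Types (R S T N : {group gT}) (f g : gT -> gT).

Lemma fhom_subl R R' S f : R' \subset R -> F R S f -> F R' S f.
Proof.
move=> sR'R Ff; have [sRP _] := fhom_obj Ff.
exact: (fhom_comp (fhom_id F sR'R sRP) Ff).
Qed.

Lemma fhom_subr R S S' f : S \subset S' -> S' \subset P -> F R S f -> F R S' f.
Proof. by move=> sSS' sS'P Ff; apply: (fhom_comp Ff (fhom_id F sSS' sS'P)). Qed.

Lemma fhom_mem R S f x : F R S f -> x \in R -> f x \in S.
Proof. by case/fhom_inj=> _ _ /subsetP fRS Rx; apply: fRS; apply: imset_f. Qed.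

Lemma fhomM R S f : F R S f -> {in R &, {morph f : x y / x * y}}.
Proof. by case/fhom_inj=> /morphicP. Qed.

Lemma fhomX R S f x n : F R S f -> x \in R -> f (x ^+ n) = f x ^+ n.
Proof.
case/fhom_inj=> mf _ _ Rx.
by rewrite -(morphmE mf) morphX.
Qed.

Lemma fhomV R S f x : F R S f -> x \in R -> f x^-1 = (f x)^-1.
Proof. by case/fhom_inj=> mf _ _ Rx; rewrite -(morphmE mf) morphV. Qed.

Definition fiso R S f := F R S f && (f @: R == S).

Lemma fisoW R S f : fiso R S f -> F R S f. Proof. by case/andP. Qed.

Lemma fiso_im R S f : fiso R S f -> f @: R = S. Proof. by case/andP=> _ /eqP. Qed.

Lemma fiso_card R S f : fiso R S f -> #|R| = #|S|.
Proof.
case/andP=> /fhom_inj[_ injf _] /eqP fR.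
by rewrite -fR card_in_imset.
Qed.

Lemma eq_fiso R S f g : {in R, f =1 g} -> fiso R S f = fiso R S g.
Proof. by move=> eqfg; rewrite /fiso (fhom_ext F S eqfg) (eq_in_imset eqfg). Qed.

Lemma cat_iso_im R S f : cat_iso F R S f -> f @: R = S.
Proof.
case=> Ff [g [Fg fK gK]]; apply/eqP; rewrite eqEsubset.
have [_ _ ->] /= := fhom_inj Ff; apply/subsetP=> y Sy.
by apply/imsetP; exists (g y); rewrite ?gK ?(fhom_mem Fg).
Qed.

Lemma fiso_cat R S f : fiso R S f -> cat_iso F R S f.
Proof.
case/andP=> Ff /eqP fR; have [T sTS isoT] := fhom_factor Ff.
suff ->: S = T by [].
by apply/val_inj; rewrite /= -fR (cat_iso_im isoT).
Qed.

Lemma cat_fiso R S f : cat_iso F R S f -> fiso R S f.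
Proof. by move=> iso; rewrite /fiso (cat_iso_im iso) eqxx; case: iso => ->. Qed.

Lemma fiso_inv R S f : fiso R S f ->
  exists2 g, fiso S R g & {in R, cancel f g} /\ {in S, cancel g f}.
Proof.
case/fiso_cat=> Ff [g [Fg fK gK]]; exists g => //.
by apply: cat_fiso; split=> //; exists f.
Qed.

Lemma fhom_fiso R S f : F R S f -> exists2 T : {group gT}, T \subset S & fiso R T f.
Proof. by case/fhom_factor=> T sTS /cat_fiso; exists T. Qed.

Lemma im_fiso R S T f : F R S f -> f @: R = T -> fiso R T f.
Proof.
move=> Ff fR; have [U _ isoU] := fhom_fiso Ff.
by suff -> : T = U by []; apply/val_inj; rewrite /= -fR (fiso_im isoU).
Qed.

Lemma fiso_comp R S T f g : fiso R S f -> fiso S T g -> fiso R T (g \o f).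
Proof.
case/andP=> Ff /eqP fR /andP[Fg /eqP gS].
by rewrite /fiso (fhom_comp Ff Fg) imset_comp fR gS eqxx.
Qed.

Lemma fiso_id R : R \subset P -> fiso R R id.
Proof. by move=> sRP; rewrite /fiso fhom_id // imset_id eqxx. Qed.

Lemma fiso_sub R S f : fiso R S f -> R \subset P /\ S \subset P.
Proof. by move/fisoW/fhom_obj. Qed.

Lemma fiso_conj R a : R \subset P -> a \in P -> fiso R (R :^ a) (conjg^~ a).
Proof.
move=> sRP Pa; rewrite /fiso eqxx andbT fhom_conj //.
by rewrite conj_subG.
Qed.

Lemma AutF_fiso R (a : {perm gT}) : a \in AutF F R -> fiso R R a.
Proof.
case/setIdP=> Aa Fa; rewrite /fiso Fa; apply/eqP.
by rewrite -(autmE Aa) -morphimEdom im_autm.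
Qed.

Lemma fiso_AutF R f : fiso R R f -> exists2 a, a \in AutF F R & {in R, a =1 f}.
Proof.
move=> isof; have [mf injf _] := fhom_inj (fisoW isof).
have injm : 'injm (morphm mf) by apply/injmP.
have im : morphm mf @* R = R by rewrite morphimEdom (fiso_im isof).
have eqf : {in R, aut injm im =1 f} by move=> x Rx; rewrite autE.
exists (aut injm im) => //; rewrite inE Aut_aut.
by rewrite (fhom_ext F R eqf) fisoW.
Qed.

Lemma AutP_sub_AutF R : R \subset P -> AutP P R \subset AutF F R.
Proof.
move=> sRP; apply/subsetP=> _ /morphimP[a /= nRa /setIP[Pa _] ->].
rewrite inE; apply/andP; split.
  by apply: (subsetP (Aut_conj_aut R 'N(R))); apply: mem_morphim.
rewrite (@fhom_ext _ _ F R R _ (conjg^~ a)); last first.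
  by move=> x Rx; rewrite norm_conj_autE.
by rewrite fhom_conj // (normP nRa).
Qed.

Lemma AutPP R (b : {perm gT}) : b \in AutP P R ->
  exists2 a, a \in 'N_P(R) & {in R, forall x, b x = x ^ a}.
Proof.
case/morphimP=> a /= nRa Na ->; exists a => // x Rx.
by rewrite norm_conj_autE.
Qed.

Lemma mem_AutP R a : a \in 'N_P(R) -> conj_aut R a \in AutP P R.
Proof. by move=> Na; apply: mem_morphim => //; case/setIP: Na. Qed.

Variable p : nat.
Hypothesis satF : saturated F p.
Hypothesis pP : p.-group P.

(** Fully normalized subgroups are fully centralized, so the extension axiom applies to [S]; the
    last hypothesis says that [N] lies in [Nphi]. *)
Lemma saturated_extend R S f N : fully_normalized F S -> fiso R S f ->
    N \subset 'N_P(R) ->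
    (forall a, a \in N ->
       exists2 b, b \in 'N_P(S) & {in R, forall x, f (x ^ a) = f x ^ b}) ->
  exists2 g, F N P g & {in R, g =1 f}.
Proof.
move=> fnS isof sNR extN; have [_ sSP] := fiso_sub isof.
have [fcS _] := satF.1 S sSP fnS.
have [g Fg gf] := satF.2 R S f (fhom_subr sSP (subxx P) (fisoW isof)) (fiso_im isof) fcS.
exists g => //; apply: fhom_subl Fg; apply/subsetP=> a Na.
apply/setIdP; split; first exact: (subsetP sNR).
have [b Nb fab] := extN a Na; rewrite (fiso_im isof).
by apply/exists_inP; exists b => //; apply/eqfun_inP.
Qed.

(** Conjugation by [N], transported along [f], is a p-subgroup of [B]; Sylow's theorem moves it into
    Aut_P(S) by an element of [B], and the twisted map then satisfies the extension condition. [B]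
    is Aut_F(S) in Alperin's theorem and the stabiliser of a decoration in [nice_extend]. *)
Lemma sylow_extend R S f N (B : {group {perm gT}}) :
    fully_normalized F S -> B \subset AutF F S ->
    p.-Sylow(B) (AutP P S :&: B) -> fiso R S f -> N \subset 'N_P(R) ->
    (forall a, a \in N ->
       exists2 b : {perm gT}, b \in B & {in R, forall x, b (f x) = f (x ^ a)}) ->
  exists b : {perm gT}, exists2 g, b \in B & F N P g /\ {in R, g =1 b \o f}.
Proof.
move=> fnS sBF sylB isof sNR extN.
have sSP := (fiso_sub isof).2; have sRP := (fiso_sub isof).1.
have [mf injf _] := fhom_inj (fisoW isof).
have injm : 'injm (morphm mf) by apply/injmP.
have imf : morphm mf @* R = S by rewrite morphimEdom (fiso_im isof).
pose th := Aut_isom injm (subxx R).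
pose K := [morphism of th] @* (conj_aut R @* N).
have nRN : N \subset 'N(R) by apply: subset_trans sNR (subsetIr _ _).
have pN : p.-group N by apply: pgroupS (subset_trans sNR (subsetIl _ _)) pP.
have thE a : a \in N -> th (conj_aut R a) \in Aut S /\
    {in R, forall x, th (conj_aut R a) (f x) = f (x ^ a)}.
  move=> Na; have nRa := subsetP nRN a Na.
  have Aa : conj_aut R a \in Aut R.
    by apply: (subsetP (Aut_conj_aut R 'N(R))); apply: mem_morphim.
  split=> [|x Rx].
    by have:= Aut_Aut_isom injm (subxx R) (conj_aut R a); rewrite imf.
  have -> : th (conj_aut R a) (f x) = f (conj_aut R a x).
    exact: (Aut_isomE injm (subxx R) Aa Rx).
  by rewrite norm_conj_autE.
have sKB : K \subset B.
  apply/subsetP=> _ /morphimP[_ _ /morphimP[a _ Na ->] ->] /=.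
  have [b Bb bE] := extN a Na; have [Aa aE] := thE a Na.
  suff ->: th (conj_aut R a) = b by [].
  apply: eq_Aut Aa _ _; first by have /setIdP[] := subsetP sBF _ Bb.
  by move=> y; rewrite -(fiso_im isof) => /imsetP[x Rx ->]; rewrite aE ?bE.
have pK : p.-group K by rewrite !morphim_pgroup.
have [b Bb sKb] := Sylow_subJ sylB sKB pK.
have Fb : b^-1 \in AutF F S by rewrite (subsetP sBF) ?groupV.
have [|g Fg gE] := saturated_extend (f := b^-1 \o f) fnS (fiso_comp isof (AutF_fiso Fb)) sNR.
  move=> a Na; have [Aa aE] := thE a Na.
  have: th (conj_aut R a) \in (AutP P S :&: B) :^ b.
    apply: (subsetP sKb); apply: mem_morphim.
      by apply: (subsetP (Aut_conj_aut R 'N(R))); apply: mem_morphim; apply: (subsetP nRN).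
    by apply: mem_morphim => //; apply: (subsetP nRN).
  case/imsetP=> c /setIP[/AutPP[d Nd cE] _] thc; exists d => // x Rx /=.
  rewrite -aE // -cE; last by rewrite (fhom_mem (fisoW (fiso_comp isof (AutF_fiso Fb)))).
  by rewrite thc /conjg !permM permK.
by exists b^-1; exists g; rewrite ?groupV.
Qed.

Lemma exists_fully_normalized R : R \subset P ->
  exists S, exists2 f, fiso R S f & fully_normalized F S.
Proof.
move=> sRP.
pose isoR S := [exists f : {ffun gT -> gT}, fiso R S f].
have isoRP S : reflect (exists f, fiso R S f) (isoR S).
  apply: (iffP existsP) => [[f isof]|[f isof]]; first by exists f.
  by exists (finfun f); rewrite (@eq_fiso _ _ _ f) // => x _; rewrite ffunE.
have isoRR : isoR R by apply/isoRP; exists id; apply: fiso_id.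
have [S /isoRP[f isof] maxS] := @arg_maxnP _ R isoR (fun S => #|'N_P(S)|) isoRR.
exists S; exists f => // T [g /cat_fiso isog].
by apply: maxS; apply/isoRP; exists (g \o f); apply: fiso_comp isof isog.
Qed.

Lemma AutF_conjP R S f (a : {perm gT}) : fiso R S f -> a \in AutF F R ->
  exists2 b : {perm gT}, b \in AutF F S & {in R, forall x, b (f x) = f (a x)}.
Proof.
move=> isof Aa; have [g isog [fK gK]] := fiso_inv isof.
have [b Ab bE] := fiso_AutF (fiso_comp isog (fiso_comp (AutF_fiso Aa) isof)).
by exists b => // x Rx; rewrite bE ?(fhom_mem (fisoW isof)) //= fK.
Qed.

End Fusion.

(** * Alperin's fusion theorem modulo a normal subgroup *)

Section InnerModulo.

Variables (gT : finGroupType) (P : {group gT}) (F : fusion_system P).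
Implicit Types (R S T Q : {group gT}) (f g : gT -> gT).

(** For trivial [Q] this says that [f] is conjugation by [u] on [R]. *)
Definition inner_mod Q R f :=
  exists2 u, u \in P & forall r, r \in R -> (r ^ u)^-1 * f r \in Q.

Variable Q : {group gT}.
Hypothesis nsQP : Q <| P.

Let memQJ x u : u \in P -> (x ^ u \in Q) = (x \in Q).
Proof. by move=> Pu; rewrite memJ_norm // (subsetP (normal_norm nsQP)). Qed.

Lemma inner_mod_sub R T f : T \subset R -> inner_mod Q R f -> inner_mod Q T f.
Proof. by move=> sTR [u Pu fu]; exists u => // r Tr; apply/fu/(subsetP sTR). Qed.

Lemma eq_inner_mod R f g : {in R, f =1 g} -> inner_mod Q R f -> inner_mod Q R g.
Proof. by move=> eqfg [u Pu fu]; exists u => // r Rr; rewrite -eqfg ?fu. Qed.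

Lemma inner_mod_comp R S f g : (forall r, r \in R -> f r \in S) ->
  inner_mod Q R f -> inner_mod Q S g -> inner_mod Q R (g \o f).
Proof.
move=> fRS [u Pu fu] [v Pv gv]; exists (u * v); first exact: groupM.
move=> r Rr /=; have /= := groupM _ (gv _ (fRS r Rr)).
move/(_ (((r ^ u)^-1 * f r) ^ v)); rewrite memQJ // fu //.
by rewrite conjMg conjVg -conjgM mulgA mulgK; apply.
Qed.

Lemma inner_mod_inv R S f g : fiso F R S f -> {in R, cancel f g} ->
  inner_mod Q R f -> inner_mod Q S g.
Proof.
move=> isof fK [u Pu fu]; exists u^-1; first by rewrite groupV.
move=> s; rewrite -(fiso_im isof) => /imsetP[r Rr ->]; rewrite fK //.
rewrite -groupV -(memQJ _ Pu) invMg invgK conjMg conjgKV conjVg.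
exact: fu.
Qed.

Variable p : nat.
Hypothesis satF : saturated F p.
Hypothesis pP : p.-group P.

Lemma proper_subnorm R : R \proper P -> #|R| < #|'N_P(R)|.
Proof.
move=> ltRP; apply: proper_card.
by apply: nilpotent_proper_norm ltRP; apply: pgroup_nil pP.
Qed.

Lemma alperin_inner_mod :
    (forall R, R \subset P -> fully_normalized F R ->
       (forall T f, F T P f -> #|R| < #|T| -> inner_mod Q T f) ->
     forall a : {perm gT}, a \in AutF F R -> inner_mod Q R a) ->
  forall R f, F R P f -> inner_mod Q R f.
Proof.
move=> autQ R; have [m leRm] := ubnP (#|P| - #|R|)%N.
elim: m => // m IHm in R leRm *.
have IH T f : F T P f -> #|R| < #|T| -> inner_mod Q T f.
  move=> Ff ltRT; have [sTP _] := fhom_obj Ff; apply: IHm Ff.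
  rewrite ltnS in leRm; apply: leq_trans leRm.
  exact: ltn_sub2l (leq_trans ltRT (subset_leq_card sTP)) ltRT.
have isoQ R' S h : #|R'| = #|R| -> fiso F R' S h -> fully_normalized F S ->
    inner_mod Q R' h.
  move=> eqR' isoh fnS; have [sRP sSP] := fiso_sub isoh.
  have autS := autQ S sSP fnS; rewrite -(fiso_card isoh) eqR' in autS.
  have [prP | ] := boolP (R' \proper P); last first.
    rewrite properE sRP negbK => sPR.
    have eqRP : R' = P by apply/val_inj/eqP; rewrite /= eqEsubset sRP.
    have eqSP : S = P.
      by apply/val_inj/eqP; rewrite /= eqEcard sSP -(fiso_card isoh) eqRP /=.
    rewrite eqRP eqSP in isoh autS *; have [a Aa ah] := fiso_AutF isoh.
    by apply: eq_inner_mod ah _; apply: autS.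
  have sylS := (satF.1 S sSP fnS).2.
  have sAut := AutP_sub_AutF F sSP.
  have sylB : p.-Sylow(Group (AutF_group_set F sSP)) (AutP P S :&: AutF F S).
    by rewrite (setIidPl sAut).
  have [||b [g Ab [Fg gE]]] := sylow_extend satF pP fnS _ sylB isoh (subxx 'N_P(R')) _.
  - exact: subxx.
  - move=> a /setIP[Pa nRa].
    have Aa : conj_aut R' a \in AutF F R'.
      by apply: (subsetP (AutP_sub_AutF F sRP)); apply: mem_AutP; apply/setIP.
    have [b Ab bE] := AutF_conjP isoh Aa; exists b => // x Rx.
    by rewrite bE // norm_conj_autE.
  have gQ : inner_mod Q R' (b \o h).
    have: inner_mod Q 'N_P(R')%G g by apply: IH Fg _; rewrite -eqR' proper_subnorm.
    move/(inner_mod_sub (_ : R' \subset 'N_P(R'))) => /(_ _)/eq_inner_mod; apply=> //.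
    by rewrite subsetI sRP normG.
  have Ab' : b^-1 \in AutF F S by rewrite (groupV (Group (AutF_group_set F sSP))).
  apply: (@eq_inner_mod _ (b^-1%g \o (b \o h))) => [x Rx /=|]; first by rewrite permK.
  apply: inner_mod_comp gQ (autS IH _ Ab') => r Rr /=.
  by rewrite (fhom_mem (fisoW (AutF_fiso Ab))) ?(fhom_mem (fisoW isoh)).
move=> f Ff; have [R' _ isof] := fhom_fiso Ff; have [sRP sR'P] := fiso_sub isof.
have [S [h isoh fnS]] := exists_fully_normalized F sRP.
have [f' isof' [fK f'K]] := fiso_inv isof.
(* [f] is [h] followed by the inverse of [h \o f'], and both of these maps end in the fully
   normalized [S]. *)
have isoh' := fiso_comp isof' isoh.
have [k isok [hK kK]] := fiso_inv isoh'.
have hQ := isoQ _ _ _ erefl isoh fnS.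
have h'Q := isoQ _ _ _ (esym (fiso_card isof)) isoh' fnS.
apply: (@eq_inner_mod _ (k \o h)) => [r Rr /=|].
  by rewrite -{1}(fK r Rr) -[h (f' (f r))]/((h \o f') (f r)) hK ?(fhom_mem (fisoW isof)).
apply: inner_mod_comp hQ (inner_mod_inv isoh' hK h'Q) => r Rr.
exact: (fhom_mem (fisoW isoh)).
Qed.

End InnerModulo.

(** * Automorphisms acting trivially modulo Q *)

Section AutModulo.

Variables (gT : finGroupType) (P : {group gT}) (F : fusion_system P).
Implicit Types (R S T Q : {group gT}) (f g : gT -> gT).

Definition autF_mod Q R : {set {perm gT}} :=
  [set a in AutF F R | [forall x in R, x^-1 * a x \in Q]].

Lemma autF_modP Q R a :
  reflect (a \in AutF F R /\ forall x, x \in R -> x^-1 * a x \in Q)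
          (a \in autF_mod Q R).
Proof.
apply: (iffP setIdP) => [] [Aa aQ]; split=> //; first exact/forall_inP.
exact/forall_inP.
Qed.

Variable Q : {group gT}.

Section Closed.

Variable R : {group gT}.
Hypothesis sRP : R \subset P.
Hypothesis clQ : forall (a : {perm gT}) x, a \in AutF F R -> x \in R :&: Q -> a x \in Q.

Let A := Group (AutF_group_set F sRP).

Let Amem (a : {perm gT}) x : a \in A -> x \in R -> a x \in R.
Proof. by move/AutF_fiso/fisoW/fhom_mem; apply. Qed.

Lemma autF_mod_group_set : group_set (autF_mod Q R).
Proof.
apply/group_setP; split=> [|a b].
  by apply/autF_modP; split=> [|x _]; rewrite ?(group1 A) // perm1 mulVg.
case/autF_modP=> Aa aQ /autF_modP[Ab bQ].
apply/autF_modP; split=> [|x Rx]; first exact: (@groupM _ A).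
rewrite permM -[b _](mulKVg (a x)) mulgA groupM ?aQ // bQ //.
exact: Amem.
Qed.

(** Conjugating [a] by [b] replaces the elements x^-1 * a x by their images under [b], which [clQ]
    keeps in [Q]. *)
Lemma autF_mod_normal : autF_mod Q R <| AutF F R.
Proof.
apply/andP; split; first by apply/subsetP=> a /autF_modP[].
apply/subsetP=> b Ab; rewrite inE; apply/subsetP=> _ /imsetP[a /autF_modP[Aa aQ] ->].
have Ab' : b^-1 \in A by rewrite groupV.
apply/autF_modP; split=> [|x Rx]; first exact: (@groupJ _ A).
have Fb := fisoW (AutF_fiso Ab); have Rbx : b^-1 x \in R by apply: Amem.
rewrite conjgE !permM -{1}[x](permKV b) -(fhomV Fb) // -(fhomM Fb) ?groupV ?Amem //.
by apply: clQ Ab _; rewrite inE aQ // groupM ?groupV ?Amem.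
Qed.

End Closed.

End AutModulo.

(** * Frattini and Sylow arguments in Aut_F(R) *)

Section Frattini.

Variables (gT : finGroupType) (P : {group gT}) (F : fusion_system P) (p : nat).
Hypothesis satF : saturated F p.
Hypothesis pP : p.-group P.
Implicit Types (R S T Q : {group gT}) (f g : gT -> gT).

Lemma strongly_closed_mem Q R f x : strongly_closed F Q -> F R P f ->
  x \in R :&: Q -> f x \in Q.
Proof.
case=> _ clQ Ff /setIP[Rx Qx]; apply: (clQ x f Qx).
by apply: fhom_subl Ff; rewrite cycle_subG.
Qed.

Lemma Phi_inner_mod : strongly_closed F 'Phi(P)%G ->
    (forall a : {perm gT}, a \in AutF F P ->
       exists2 u, u \in P & {in P, forall x, a x = x ^ u}) ->
  forall R f, F R P f -> inner_mod P 'Phi(P)%G R f.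
Proof.
move=> clPhi innP; have nsPhiP := Phi_normal P.
apply: (alperin_inner_mod nsPhiP satF pP) => R sRP fnR IH a Aa.
have [prP | ] := boolP (R \proper P); last first.
  rewrite properE sRP negbK => sPR.
  have eqRP : R = P by apply/val_inj/eqP; rewrite /= eqEsubset sRP.
  rewrite eqRP in Aa *; have [u Pu aE] := innP a Aa.
  by exists u => // x Px; rewrite aE ?mulVg ?group1.
have clR (b : {perm gT}) x : b \in AutF F R -> x \in R :&: 'Phi(P)%G -> b x \in 'Phi(P).
  move=> Ab; apply: (strongly_closed_mem clPhi).
  exact: fhom_subr sRP (subxx P) (fisoW (AutF_fiso Ab)).
pose A := Group (AutF_group_set F sRP).
pose K := Group (autF_mod_group_set F 'Phi(P)%G sRP).
have nsKA : K <| A by apply: autF_mod_normal.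
have sylA := (satF.1 R sRP fnR).2.
have sSK : AutP P R \subset K.
  apply/subsetP=> b Sb; have [u /setIP[Pu _] bE] := AutPP Sb.
  apply/autF_modP; split; first exact: subsetP (AutP_sub_AutF F sRP) b Sb.
  move=> x Rx; rewrite bE // -commgEl.
  have sP'Phi : P^`(1) \subset 'Phi(P) by rewrite (Phi_joing pP) joing_subl.
  by apply: (subsetP sP'Phi); rewrite derg1 mem_commg //; apply: (subsetP sRP).
have sylK := pHall_subl sSK (normal_sub nsKA) sylA.
have: a \in K * 'N_A(AutP P R) by rewrite (Frattini_arg nsKA sylK).
case/mulsgP=> k n /autF_modP[Ak kQ] /setIP[An nSn] ->.
have inR (b : {perm gT}) x : b \in AutF F R -> x \in R -> b x \in R.
  by move/AutF_fiso/fisoW/fhom_mem; apply.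
(* Since [n] normalises Aut_P(R), it carries conjugation by an element of N_P(R) to another such
   conjugation, and so extends to N_P(R). *)
have [|c Nc|g Fg gE] := saturated_extend (N := 'N_P(R)) satF fnR (AutF_fiso An).
- exact: subxx.
- have /AutPP[d Nd dE] : conj_aut R c ^ n \in AutP P R.
    by rewrite memJ_norm ?mem_AutP.
  exists d => // x Rx; rewrite -dE ?inR // conjgE !permM permK.
  by rewrite norm_conj_autE //; case/setIP: Nc.
apply: (@eq_inner_mod _ _ _ _ (n \o k)) => [x _|]; first by rewrite permM.
apply: (inner_mod_comp nsPhiP (S := R)); first by move=> x; apply: inR.
  by exists 1 => [|x Rx]; rewrite ?group1 // conjg1 kQ.
apply: eq_inner_mod gE _; apply: inner_mod_sub (IH _ _ Fg _).
  by rewrite subsetI sRP normG.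
exact: (proper_subnorm pP prP).
Qed.

(** All p'-elements lie in the kernel [K] of the action modulo [Q], so A / K is a p-group and the
    Sylow subgroup Aut_P(R) maps onto it. *)
Lemma sylow_inner_mod Q R : Q <| P -> R \subset P ->
    p.-Sylow(AutF F R) (AutP P R) ->
    (forall (a : {perm gT}) x, a \in AutF F R -> x \in R :&: Q -> a x \in Q) ->
    (forall a : {perm gT}, a \in AutF F R -> p^'.-elt a ->
       forall x, x \in R -> x^-1 * a x \in Q) ->
  forall a : {perm gT}, a \in AutF F R -> inner_mod P Q R a.
Proof.
move=> nsQP sRP sylS clQ p'Q a Aa.
pose A := Group (AutF_group_set F sRP).
pose K := Group (autF_mod_group_set F Q sRP).
have nsKA : K <| A by apply: autF_mod_normal.
have pAK : p.-group (A / K).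
  apply/pgroupP=> q q_pr /(Cauchy q_pr)[_ /morphimP[x Nx Ax ->] ox].
  have Kx : x.`_p^' \in K.
    apply/autF_modP; split; first exact: (groupX _ Ax).
    by apply: p'Q; [apply: (groupX _ Ax) | apply: p_elt_constt].
  have xE : coset K x = coset K x.`_p.
    rewrite -{1}(consttC p x) morphM ?groupX //= (coset_id Kx) mulg1 //.
  have: p.-elt (coset K x).
    by rewrite xE morph_p_elt ?p_elt_constt ?groupX.
  rewrite /p_elt ox => /pnatP; apply=> //.
  exact: prime_gt0.
have nKS : AutP P R \subset 'N(K).
  exact: subset_trans (AutP_sub_AutF F sRP) (normal_norm nsKA).
have sylSK : p.-Sylow(A / K) (AutP P R / K).
  by apply: quotient_pHall => //; apply: sylS.
have eqSA : AutP P R / K = A / K.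
  have [sSA _ p'SA] := and3P sylSK; apply/eqP; rewrite eqEsubset sSA /=.
  have: #|A / K : (conj_aut R @* 'N_P(R))%G / K| == 1%N.
    by apply/eqP/(@pnat_1 p); [apply: pnat_dvd (dvdn_indexg _ _) pAK | exact: p'SA].
  by rewrite indexg_eq1.
have : coset K a \in AutP P R / K by rewrite eqSA mem_quotient.
case/morphimP=> b Nb Sb eqab.
have Na : a \in 'N(K) by apply: subsetP (normal_norm nsKA) a Aa.
have : a \in K :* b by apply/rcoset_kercosetP.
case/rcosetP=> k /autF_modP[Ak kQ] ->.
apply: (@eq_inner_mod _ _ _ _ (b \o k)) => [x _|]; first by rewrite permM.
apply: (inner_mod_comp nsQP (S := R)).
- by move=> x; apply: fhom_mem (fisoW (AutF_fiso Ak)).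
- by exists 1 => [|x Rx]; rewrite ?group1 // conjg1 kQ.
have [u /setIP[Pu _] bE] := AutPP Sb; exists u => // x Rx.
by rewrite bE // mulVg group1.
Qed.

End Frattini.

(** * Transfer on the Frattini subgroup *)

Section TransferPhi.

Variables (gT : finGroupType) (p : nat) (P : {group gT}).
Hypothesis p_pr : prime p.
Hypothesis pP : p.-group P.

Lemma abelem_Fp : p.-abelem [set: 'F_p].
Proof.
rewrite abelemE // zmod_abelian; apply/exponentP=> x _.
by rewrite zmodXgE -mulr_natr pchar_Fp_0 // mulr0.
Qed.

Lemma morph_Phi_Fp (h : {morphism P >-> 'F_p}) q : q \in 'Phi(P) -> h q = 0%R.
Proof.
move=> Phi_q; have Pq := subsetP (Phi_sub P) q Phi_q.
have: h q \in h @* 'Phi(P) by apply: mem_morphim.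
rewrite (morphim_Phi h pP) //.
have: p.-abelem (h @* P) by apply: abelemS (subsetT _) abelem_Fp.
rewrite -trivg_Phi ?morphim_pgroup // => /eqP->.
by move/set1P.
Qed.

Variables (R : {group gT}) (k : gT -> 'F_p).
Hypothesis sRP : R \subset P.
Hypothesis kM : {in R &, forall x y, k (x * y) = (k x + k y)%R}.

(** The sum is the cycle expansion at [q] of the transfer of [k] from R to P, a homomorphism P ->
    F_p. *)
Lemma transfer_Phi_Fp q X : q \in 'Phi(P) ->
    is_transversal X (rcosets R P :* <[q]>) P ->
  (\sum_(x in X) k ((q ^+ #|<[q]> : R :* x|) ^ x^-1) = 0)%R.
Proof.
move=> Phi_q trX; have Pq := subsetP (Phi_sub P) q Phi_q.
pose al := Morphism kM.
have abA : abelian (al @* R) by apply: abelianS (subsetT _) (zmod_abelian _).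
pose V := transfer P abA.
have VM : {in P &, {morph (fun g => FiniteModule.fmval (V g)) : x y / x * y}}.
  by move=> x y Px Py /=; rewrite /V transferM.
have /= := morph_Phi_Fp (Morphism VM) Phi_q.
rewrite /V (transfer_cycle_expansion sRP _ Pq trX) => V0.
rewrite -[RHS]V0 FiniteModule.fmval_sum; apply: (@eq_bigr 'F_p 0%R +%R) => x Xx /=.
have Rqx : (q ^+ #|<[q]> : R :* x|) ^ x^-1 \in R.
  have := mulg_exp_card_rcosets R q x.
  by rewrite mem_rcoset conjgE invgK mulgA.
by rewrite FiniteModule.fmodK //; apply: (mem_morphim al).
Qed.

End TransferPhi.

(** * Decorated orbits *)

Section DecoratedOrbits.

Variables (gT : finGroupType) (p : nat) (P Q : {group gT}).
Variable lam : gT -> 'F_p.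
Hypothesis nsQP : Q <| P.
Hypothesis lamJ : {in Q & P, forall x u, lam (x ^ u) = lam x}.

Implicit Types (R S T : {group gT}).

Notation deco := {ffun gT -> 'F_p}.
Implicit Types (c d : deco).

(* Functions are normalised to vanish off R :&: Q, so that decorations which  *)
(* agree on R :&: Q are equal.                                                *)
Definition decoration R c : bool :=
  [exists k : deco, [forall x in R, forall y in R, k (x * y) == (k x + k y)%R]
                  && [forall x in R :&: Q, c x == (lam x + k x)%R]]
  && [forall x, (x \notin R :&: Q) ==> (c x == 0%R)].

Lemma decorationP R c :
  reflect ((exists2 k : gT -> 'F_p, {in R &, forall x y, k (x * y) = (k x + k y)%R}
                                & {in R :&: Q, forall x, c x = (lam x + k x)%R})
           /\ forall x, x \notin R :&: Q -> c x = 0%R)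
          (decoration R c).
Proof.
apply: (iffP andP) => [[/existsP[k /andP[kM ck] c0]] | [[k kM ck] c0]]; split.
- exists k => [x y Rx Ry | x Rx].
    by apply/eqP; move/forall_inP: kM => /(_ x Rx)/forall_inP; apply.
  by apply/eqP; move/forall_inP: ck; apply.
- by move=> x nRx; apply/eqP; move/forallP: c0 => /(_ x)/implyP; apply.
- apply/existsP; exists (finfun k); apply/andP; split.
    by apply/forall_inP=> x Rx; apply/forall_inP=> y Ry; rewrite !ffunE kM.
  by apply/forall_inP=> x Rx; rewrite ffunE ck.
by apply/forallP=> x; apply/implyP=> nRx; rewrite c0.
Qed.

Definition pull R (f : gT -> gT) c : deco :=
  [ffun x => if x \in R :&: Q then c (f x) else 0%R].

Lemma pullE R f c : {in R :&: Q, pull R f c =1 c \o f}.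
Proof. by move=> x Rx; rewrite ffunE Rx. Qed.

Lemma eq_pull R f g c : {in R :&: Q, f =1 g} -> pull R f c = pull R g c.
Proof. by move=> eqfg; apply/ffunP=> x; rewrite !ffunE; case: ifP => // /eqfg->. Qed.

Lemma pull_id R c : decoration R c -> pull R id c = c.
Proof.
case/decorationP=> _ c0; apply/ffunP=> x; rewrite ffunE.
by case: ifPn => // /c0.
Qed.

(** [k] has abelian target and [lam] is P-invariant. Hence the decoration of a coset R x does not
    depend on the representative x. *)
Lemma decoJ R c x r : R \subset P -> decoration R c -> x \in R :&: Q -> r \in R ->
  c (x ^ r) = c x.
Proof.
move=> sRP /decorationP[[k kM ck] _] Rx Rr; have /setIP[Rx' Qx] := Rx.
have Pr := subsetP sRP r Rr.
have Rxr : x ^ r \in R :&: Q.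
  by rewrite inE groupJ // memJ_norm // (subsetP (normal_norm nsQP)).
rewrite !ck // lamJ //; congr (_ + _)%R.
apply: (@addrI _ (k r)); rewrite -kM ?groupJ // -conjgC kM //.
by rewrite addrC.
Qed.

Lemma decoration_conj R T c x : x \in P -> T :^ x^-1 \subset R ->
  decoration R c -> decoration T (pull T (conjg^~ x^-1) c).
Proof.
move=> Px sTR /decorationP[[k kM ck] _].
have Tx s : s \in T -> s ^ x^-1 \in R by move=> Ts; rewrite (subsetP sTR) ?memJ_conjg.
apply/decorationP; split=> [|s nTs]; last by rewrite ffunE (negPf nTs).
exists (fun s => k (s ^ x^-1)) => [s t Ts Tt | s TQs]; first by rewrite conjMg kM ?Tx.
have /setIP[Ts Qs] := TQs; rewrite pullE //= ck ?lamJ ?groupV //.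
by rewrite inE Tx // memJ_norm // groupV (subsetP (normal_norm nsQP)).
Qed.

(* The point R x of R \ P has stabiliser R :^ x and carries the decoration    *)
(* s |-> t.2 (s ^ x^-1) of it; orbit_points t u is the set of the points of   *)
(* the decorated orbit t that are fixed by u.1 with decoration u.2 on u.1.    *)
Definition orbit_points (t u : {group gT} * deco) : {set {set gT}} :=
  [set C in rcosets t.1 P | [forall x in C,
     (u.1 :^ x^-1 \subset t.1)
      && [forall s in u.1 :&: Q, t.2 (s ^ x^-1) == u.2 s]]].

Lemma orbit_pointsP R c S d x : R \subset P -> decoration R c -> x \in P ->
  reflect (S :^ x^-1 \subset R /\ {in S :&: Q, forall s, c (s ^ x^-1) = d s})
          (R :* x \in orbit_points (R, c) (S, d)).
Proof.
move=> sRP Rc Px; rewrite inE /= -rcosetE imset_f //= rcosetE.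
apply: (iffP forall_inP) => [/(_ x (rcoset_refl _ _))/andP[sSR /eqfun_inP] // |].
case=> sSR cd _ /rcosetP[r Rr ->]; rewrite invMg conjsgM.
have Rr' : r^-1 \in R by rewrite groupV.
rewrite -{1}(conjGid Rr') conjSg sSR; apply/eqfun_inP=> s Ss /=.
rewrite conjgM (decoJ sRP Rc) ?cd //; have /setIP[Ss' Qs] := Ss.
rewrite inE (subsetP sSR) ?memJ_conjg //.
by rewrite memJ_norm // groupV (subsetP (normal_norm nsQP)).
Qed.

Lemma orbit_points_coset R c S d C : C \in orbit_points (R, c) (S, d) ->
  exists2 x, x \in P & C = R :* x.
Proof. by case/setIdP=> /rcosetsP. Qed.

Definition deco_norm S d : {set gT} :=
  [set a in 'N_P(S) | [forall s in S :&: Q, d (s ^ a) == d s]].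

Lemma deco_normP S d a :
  reflect (a \in 'N_P(S) /\ {in S :&: Q, forall s, d (s ^ a) = d s})
          (a \in deco_norm S d).
Proof. by apply: (iffP setIdP) => [] [Na /eqfun_inP]. Qed.

Lemma memJ_normIQ S a s : a \in 'N_P(S) -> (s ^ a \in S :&: Q) = (s \in S :&: Q).
Proof.
case/setIP=> Pa nSa.
by rewrite !inE !memJ_norm // (subsetP (normal_norm nsQP)).
Qed.

Lemma deco_norm_group_set S d : group_set (deco_norm S d).
Proof.
apply/group_setP; split=> [|a b /deco_normP[Na ad] /deco_normP[Nb bd]].
  by apply/deco_normP; rewrite group1; split=> // s _; rewrite conjg1.
apply/deco_normP; rewrite groupM //; split=> // s Ss.
by rewrite conjgM bd ?ad ?memJ_normIQ.
Qed.
Canonical deco_norm_group S d := Group (deco_norm_group_set S d).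

Lemma sub_deco_norm S d : S \subset P -> decoration S d -> S \subset deco_norm S d.
Proof.
move=> sSP Sd; apply/subsetP=> a Sa; apply/deco_normP.
by rewrite inE (subsetP sSP) // (subsetP (normG S)) //; split=> // s Ss; apply: decoJ Ss Sa.
Qed.

Lemma orbit_points_acts R c S d : R \subset P -> decoration R c ->
  [acts deco_norm S d, on orbit_points (R, c) (S, d) | 'Rs].
Proof.
move=> sRP Rc; apply/subsetP=> a /deco_normP[Na ad].
rewrite !inE; apply/subsetP=> C CX; rewrite inE.
have [x Px eqC] := orbit_points_coset CX; rewrite {}eqC in CX *.
have /setIP[Pa nSa] := Na; have /(orbit_pointsP _ _ sRP Rc Px)[sSR cd] := CX.
rewrite /= rcosetE -rcosetM; apply/(orbit_pointsP _ _ sRP Rc); first exact: groupM.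
have Na' : a^-1 \in 'N_P(S) by rewrite groupV.
have nSa' : S :^ a^-1 = S by apply/normP; rewrite groupV.
rewrite invMg conjsgM nSa'; split=> // s Ss.
rewrite conjgM cd ?memJ_normIQ //.
by rewrite -{2}(conjgKV a s) ad // memJ_normIQ.
Qed.

(** A point fixed by S and [a] is fixed by T and carries a single decoration [res] on T, which
    restricts to [d]. When [a] is outside S, this expresses fixed points through marks at a larger
    subgroup. *)
Lemma orbit_points_fixed R c S d a : R \subset P -> decoration R c ->
    decoration S d -> S \subset P -> a \in deco_norm S d ->
  let T := (S <*> <[a]>)%G in
  #|'Fix_(orbit_points (R, c) (S, d) | 'Rs)[a]| =
  (\sum_(e | decoration T e && (pull S id e == d)) #|orbit_points (R, c) (T, e)|)%N.
Proof.
move=> sRP Rc Sd sSP Na T.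
pose res (C : {set gT}) := pull T (fun s => s ^ (repr C)^-1) c.
have sST : S \subset T by apply: joing_subl.
have Pa : a \in P by have /deco_normP[/setIP[]] := Na.
have sTP : T \subset P by rewrite join_subG sSP cycle_subG.
have memTQ x s : T :^ x^-1 \subset R -> x \in P -> s \in T :&: Q -> s ^ x^-1 \in R :&: Q.
  move=> sTR Px /setIP[Ts Qs]; rewrite inE (subsetP sTR) ?memJ_conjg //.
  by rewrite memJ_norm // groupV (subsetP (normal_norm nsQP)).
have resE x : x \in P -> T :^ x^-1 \subset R ->
    decoration T (res (R :* x)) /\ {in T :&: Q, forall s, res (R :* x) s = c (s ^ x^-1)}.
  move=> Px sTR.
  have cE : {in T :&: Q, forall s, res (R :* x) s = c (s ^ x^-1)}.
    move=> s Ts; rewrite pullE //=; case: repr_rcosetP => r Rr.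
    by rewrite invMg conjgM (decoJ sRP Rc) ?groupV ?memTQ.
  split=> //; have -> : res (R :* x) = pull T (conjg^~ x^-1) c.
    apply/ffunP=> s; case: (boolP (s \in T :&: Q)) => Ts; first by rewrite cE // [RHS]pullE.
    by rewrite !ffunE (negPf Ts).
  exact: decoration_conj Rc.
have fixP x : x \in P ->
  (R :* x \in 'Fix_(orbit_points (R, c) (S, d) | 'Rs)[a]) =
    (R :* x \in orbit_points (R, c) (S, d)) && (T :^ x^-1 \subset R).
  move=> Px; rewrite inE; apply: andb_id2l => /(orbit_pointsP _ _ sRP Rc Px)[sSR cd].
  rewrite conjYg join_subG sSR -cycleJ cycle_subG conjgE invgK mulgA.
  rewrite -mem_rcoset (sameP afix1P eqP) /= rcosetE -rcosetM.
  by rewrite (sameP eqP (rcoset_eqP)) rcoset_sym (sameP rcoset_eqP eqP).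
have pointsE e : decoration T e && (pull S id e == d) ->
  orbit_points (R, c) (T, e) =
    [set C in 'Fix_(orbit_points (R, c) (S, d) | 'Rs)[a] | res C == e].
  case/andP=> Te /eqP eS; apply/setP=> C; apply/idP/setIdP.
    move=> CX; have [x Px eqC] := orbit_points_coset CX.
    rewrite {}eqC in CX *; have /(orbit_pointsP _ _ sRP Rc Px)[sTR ce] := CX.
    have [_ rE] := resE x Px sTR.
    rewrite fixP // sTR andbT; split; last first.
      apply/eqP/ffunP=> s; case: (boolP (s \in T :&: Q)) => Ts; first by rewrite rE ?ce.
      by have /decorationP[_ ->] := Te; rewrite // ffunE (negPf Ts).
    apply/(orbit_pointsP _ _ sRP Rc Px); split.
      by apply: subset_trans sTR; rewrite conjSg.
    by move=> s Ss; rewrite -eS pullE // ce // (subsetP (setSI _ sST)).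
  case=> FC /eqP rC; have /setIP[CX _] := FC.
  have [x Px eqC] := orbit_points_coset CX.
  rewrite {}eqC in CX FC rC *; rewrite fixP // in FC; case/andP: FC => _ sTR.
  apply/(orbit_pointsP _ _ sRP Rc Px); split=> // s Ts.
  by rewrite -rC; have [_ ->] := resE x Px sTR.
rewrite -sum1_card (partition_big res (fun e => decoration T e && (pull S id e == d))) /=.
  apply: eq_bigr => e /pointsE->; rewrite -sum1dep_card.
  by apply: eq_bigl => C; rewrite inE.
move=> C FC; have /setIP[CX _] := FC.
have [x Px eqC] := orbit_points_coset CX; rewrite {}eqC in CX FC *.
rewrite fixP // in FC; case/andP: FC => _ sTR.
have [rT rE] := resE x Px sTR; rewrite rT /=.
have /(orbit_pointsP _ _ sRP Rc Px)[_ cd] := CX.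
apply/eqP/ffunP=> s; rewrite ffunE; case: ifPn => Ss /=.
  by rewrite rE ?cd // (subsetP (setSI _ sST)).
by have /decorationP[_ ->] := Sd.
Qed.

End DecoratedOrbits.

(** * Congruences between marks of virtual decorated sets *)

Section Stabilise.

Variables (gT : finGroupType) (p : nat) (P Q : {group gT}) (F : fusion_system P).
Variable lam : gT -> 'F_p.
Hypothesis nsQP : Q <| P.
Hypothesis lamM : {in Q &, forall x y, lam (x * y) = (lam x + lam y)%R}.
Hypothesis lamJ : {in Q & P, forall x u, lam (x ^ u) = lam x}.
Hypothesis innQ : forall R f, F R P f -> inner_mod P Q R f.

Implicit Types (R S T : {group gT}) (f g : gT -> gT).
Notation deco := {ffun gT -> 'F_p}.
Implicit Types (c d e : deco).
Notation decoration := (decoration Q lam).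
Notation pull := (pull Q).
Notation orbit_points := (orbit_points P Q).
Notation deco_norm := (deco_norm P Q).

Let memQJ x u : u \in P -> (x ^ u \in Q) = (x \in Q).
Proof. by move=> Pu; rewrite memJ_norm // (subsetP (normal_norm nsQP)). Qed.

Lemma fhom_memQ R S f x : F R S f -> x \in R -> (f x \in Q) = (x \in Q).
Proof.
move=> Ff Rx; have [_ sSP] := fhom_obj Ff.
have [u Pu fu] := innQ (fhom_subr sSP (subxx P) Ff).
rewrite -[f x](mulKVg (x ^ u)) groupMr ?fu //.
exact: memQJ.
Qed.

Lemma fhom_memIQ R S f x : F R S f -> x \in R :&: Q -> f x \in S :&: Q.
Proof.
by move=> Ff /setIP[Rx Qx]; rewrite inE (fhom_mem Ff) // (fhom_memQ Ff).
Qed.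

Lemma pull_comp R S T f g d : F R S f -> F S T g ->
  pull R f (pull S g d) = pull R (g \o f) d.
Proof.
move=> Ff Fg; apply/ffunP=> x; rewrite !ffunE; case: ifP => // Rx.
by rewrite (fhom_memIQ Ff Rx).
Qed.

(** If [f] is conjugation by [u] modulo Q, the error term x |-> lam ((x ^ u)^-1 * f x) is a
    homomorphism on R, because [lam] is additive and P-invariant; it is added to [k \o f]. *)
Lemma pull_decoration R S f d : F R S f -> decoration S d -> decoration R (pull R f d).
Proof.
move=> Ff /decorationP[[k kM dk] _].
have [_ sSP] := fhom_obj Ff; have FfP := fhom_subr sSP (subxx P) Ff.
have [u Pu fu] := innQ FfP.
apply/decorationP; split=> [|x nRx]; last by rewrite ffunE (negPf nRx).
exists (fun x => k (f x) + lam ((x ^ u)^-1 * f x))%R => [x y Rx Ry | x RQx].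
  rewrite (fhomM Ff) // kM ?(fhom_mem Ff) // -!addrA; congr (_ + _)%R.
  rewrite addrCA; congr (_ + _)%R.
  have Px : x \in P by case: (fhom_obj Ff) => /subsetP->.
  have Py : y \in P by case: (fhom_obj Ff) => /subsetP->.
  have ->: ((x * y) ^ u)^-1 * (f x * f y) =
           ((x ^ u)^-1 * f x) ^ (y ^ u) * ((y ^ u)^-1 * f y).
    by rewrite (conjMg x y u) invMg; move: (y ^ u) (x ^ u) => z w; rewrite conjgE !mulgA mulgK.
  have Qx := fu x Rx.
  by rewrite lamM ?memQJ ?fu ?groupJ // lamJ ?fu ?groupJ.
have /setIP[Rx Qx] := RQx.
rewrite pullE //= dk ?(fhom_memIQ Ff) // addrC [RHS]addrCA; congr (_ + _)%R.
have ->: f x = x ^ u * ((x ^ u)^-1 * f x) by rewrite mulKVg.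
by rewrite mulKg lamM ?memQJ ?fu // lamJ // mulKVg.
Qed.

(** Integer coefficients allow the corrections made in [fix_class] to be negative. *)
Definition virtual_set := seq (({group gT} * deco) * int).
Implicit Types (X : virtual_set) (u v : {group gT} * deco).

Definition decorated X : bool :=
  all (fun i : ({group gT} * deco) * int => (i.1.1 \subset P) && decoration i.1.1 i.1.2) X.

Definition vmark X u : int :=
  (\sum_(i <- X) i.2 * #|orbit_points i.1 u|%:R)%R.

Definition vfix X u a : int :=
  (\sum_(i <- X) i.2 * #|'Fix_(orbit_points i.1 u | 'Rs)[a]|%:R)%R.

(** Cauchy-Frobenius: each orbit in X contributes its coefficient times |H| times a number of
    H-orbits. *)
Lemma vfix_dvd X S d (H : {group gT}) : decorated X -> H \subset deco_norm S d ->
  (#|H|%:Z %| (\sum_(a in H) vfix X (S, d) a)%R)%Z.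
Proof.
move=> dX sHN; rewrite /vfix exchange_big /=; elim: X dX => [|[[R c] n] X IHX] /=.
  by rewrite big_nil dvdz0.
case/andP=> /andP[sRP Rc] dX; rewrite big_cons rpredD ?IHX //=.
rewrite -mulr_sumr dvdz_mull // -natr_sum.
rewrite Frobenius_Cauchy; last first.
  apply: subset_trans sHN _; exact: (orbit_points_acts nsQP lamJ _ _ sRP Rc).
by rewrite natrM natz [X in (_ * X)%R]natz dvdz_mull.
Qed.

Lemma vfixE X S d a : decorated X -> decoration S d -> S \subset P ->
    a \in deco_norm S d ->
  vfix X (S, d) a = (\sum_(e | decoration (S <*> <[a]>)%G e && (pull S id e == d))
                       vmark X ((S <*> <[a]>)%G, e))%R.
Proof.
move=> dX Sd sSP Na; rewrite /vmark exchange_big /= /vfix.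
elim: X dX => [|[[R c] n] X IHX] /=; first by rewrite !big_nil.
case/andP=> /andP[sRP Rc] dX; rewrite !big_cons IHX //; congr (_ + _)%R.
by rewrite /= (orbit_points_fixed nsQP lamJ sRP Rc Sd sSP Na) -mulr_sumr -natr_sum.

Qed.

Lemma vfix_id X S d a : decorated X -> a \in S -> vfix X (S, d) a = vmark X (S, d).
Proof.
move=> dX Sa; rewrite /vfix /vmark; apply: eq_big_seq => -[[R c] n] Xi /=.
have /andP[/= sRP Rc] := allP dX _ Xi.
congr (_ * _%:R)%R; apply: eq_card => C; rewrite inE andbC.
apply: andb_idl => CX; have [x Px eqC] := orbit_points_coset CX.
rewrite {}eqC in CX *; have /(orbit_pointsP nsQP lamJ _ _ sRP Rc Px)[sSR _] := CX.
apply/afix1P; rewrite /= rcosetE -rcosetM; apply/rcoset_eqP.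
have: a ^ x^-1 \in R by rewrite (subsetP sSR) // memJ_conjg.
by rewrite mem_rcoset conjgE invgK mulgA.
Qed.

Definition stable_at X u : Prop := forall S' f,
  fiso F S' u.1 f -> vmark X (S', pull S' f u.2) = vmark X u.

Lemma deco_norm_im S S' d g a : F (deco_norm_group nsQP S' (pull S' g d)) P g ->
    S' \subset deco_norm S' (pull S' g d) -> g @: S' = S -> 
  a \in deco_norm S' (pull S' g d) -> g a \in deco_norm S d.
Proof.
move=> Fg sS'N gS Na; have /(@deco_normP _ _ P Q)[NPa ad] := Na.
have gJ s : s \in S' -> g (s ^ a) = g s ^ g a.
  move=> Ss; have Ns := subsetP sS'N s Ss.
  by rewrite !conjgE !(fhomM Fg) ?groupM ?groupV ?(fhomV Fg).
apply/deco_normP; split.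
  rewrite inE (fhom_mem Fg) //=; apply/normP/eqP; rewrite eqEcard cardJg leqnn andbT.
  apply/subsetP=> _ /imsetP[s Ss ->]; move: Ss; rewrite -gS => /imsetP[s' Ss' ->].
  by rewrite -gJ // imset_f // memJ_norm //; case/setIP: NPa.
move=> y /setIP[]; rewrite -{1}gS => /imsetP[s Ss ->] gsQ.
have sQ : s \in S' :&: Q by rewrite inE Ss -(fhom_memQ Fg) ?(subsetP sS'N).
have := ad s sQ; rewrite !ffunE (memJ_normIQ nsQP) // sQ gJ //.
Qed.

(** By [vfixE] both sides are sums of marks at <S, g a> and <S', a>. As [a] is outside S', these are
    larger than S, and stability matches the terms along [g]. *)
Lemma vfix_transport X S S' d g a : decorated X -> decoration S d -> S \subset P ->
    (forall T e, decoration T e -> #|S| < #|T| -> stable_at X (T, e)) ->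
    decoration S' (pull S' g d) -> S' \subset P ->
    F (deco_norm_group nsQP S' (pull S' g d)) P g -> g @: S' = S ->
    a \in deco_norm S' (pull S' g d) -> a \notin S' ->
  vfix X (S, d) (g a) = vfix X (S', pull S' g d) a.
Proof.
move=> dX Sd sSP stX Sd' sSP' Fg gS Na nSa.
have sS'N := sub_deco_norm nsQP lamJ sSP' Sd'.
have Nga := deco_norm_im Fg sS'N gS Na.
have isog : fiso F (S' <*> <[a]>)%G (S <*> <[g a]>)%G g.
  have [mg _ _] := fhom_inj Fg.
  have sTN : (S' <*> <[a]>)%G \subset deco_norm_group nsQP S' (pull S' g d).
    by rewrite join_subG sS'N cycle_subG.
  have gE (A : {set gT}) : A \subset deco_norm_group nsQP S' (pull S' g d) ->
    morphm mg @* A = g @: A by move=> sAN; rewrite morphimEsub.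
  apply: (im_fiso (fhom_subl sTN Fg)); rewrite /= -gE // morphimY ?cycle_subG //.
  by rewrite morphim_cycle // gE // gS.
rewrite !vfixE //; move: isog; set T := (S <*> _)%G; set T' := (S' <*> _)%G => isog.
have [h isoh [gK hK]] := fiso_inv isog.
have Fg' := fisoW isog; have Fh := fisoW isoh.
have pK e : decoration T e -> pull T h (pull T' g e) = e.
  move=> Te; rewrite (pull_comp _ Fh Fg') -[RHS](pull_id Te).
  by apply: eq_pull => x /setIP[Tx _]; apply: hK.
have pK' e : decoration T' e -> pull T' g (pull T h e) = e.
  move=> Te; rewrite (pull_comp _ Fg' Fh) -[RHS](pull_id Te).
  by apply: eq_pull => x /setIP[Tx _]; apply: gK.
rewrite [RHS](reindex_onto (pull T' g) (pull T h)) /=; last by move=> e /andP[/pK'].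
apply: eq_big => e; last first.
  case/andP=> Te _; have := stX T e Te _ _ _ isog; rewrite /= => <- //.
  rewrite -(fiso_card isog); rewrite -(fiso_card (im_fiso (fhom_subl sS'N Fg) gS)).
  apply: proper_card; rewrite properE joing_subl join_subG subxx cycle_subG.
  by rewrite (negPf nSa).
have sST : S \subset T by apply: joing_subl.
have sST' : S' \subset T' by apply: joing_subl.
have Fg'' : F S' P g := fhom_subl sS'N Fg.
apply/andP/andP=> [[Te /eqP eS] | [/andP[Te /eqP eS] /eqP pe]].
  rewrite (pull_decoration Fg') // pK // eqxx; split=> //=; apply/eqP/ffunP=> x.
  rewrite !ffunE; case: ifP => // Sx; have /setIP[Sx' Qx] := Sx.
  rewrite inE (subsetP sST') // Qx /= -eS ffunE.
  by rewrite inE -{1}gS imset_f // (fhom_memQ Fg'') // Qx.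
split; first by rewrite -pe (pull_decoration Fh).
apply/eqP/ffunP=> y; rewrite ffunE; case: ifPn => [| nSy]; last first.
  by have /decorationP[_ ->] := Sd.
case/setIP; rewrite -{1}gS => /imsetP[x Sx ->]; rewrite (fhom_memQ Fg'') // => Qx.
have SQx : x \in S' :&: Q by rewrite inE Sx.
have := congr1 (fun k : deco => k x) eS; rewrite !ffunE SQx.
by rewrite inE (subsetP sST') // Qx.
Qed.

(* Sum the numbers of fixed points over a in N_P(S', d'): for a outside S'    *)
(* they agree by stability above S, so only the |S'| equal terms for a in S'  *)
(* remain.                                                                    *)
Lemma vmark_congr X S S' d g : decorated X -> decoration S d -> S \subset P ->
    (forall T e, decoration T e -> #|S| < #|T| -> stable_at X (T, e)) ->
    decoration S' (pull S' g d) -> S' \subset P ->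
    F (deco_norm_group nsQP S' (pull S' g d)) P g -> g @: S' = S ->
  (#|deco_norm S' (pull S' g d)|%:Z %|
     (#|S'|%:R * (vmark X (S, d) - vmark X (S', pull S' g d)))%R)%Z.
Proof.
move=> dX Sd sSP stX Sd' sSP' Fg gS.
have sS'N := sub_deco_norm nsQP lamJ sSP' Sd'.
set d' := pull S' g d in Sd' Fg sS'N *; set N' := deco_norm_group nsQP S' d' in Fg *.
have [_ injg _] := fhom_inj Fg.
have [H _ /fiso_im gH] := fhom_fiso Fg.
have sHN : H \subset deco_norm S d.
  by apply/subsetP=> b; rewrite -gH => /imsetP[a Na ->]; apply: deco_norm_im Na.
have cardH : #|H| = #|N'| by rewrite -gH card_in_imset.
have dvN : (#|H|%:Z %| (\sum_(a in N') vfix X (S', d') a)%R)%Z.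
  by rewrite cardH; apply: vfix_dvd.
have := rpredB (vfix_dvd dX sHN) dvN.
rewrite cardH -gH big_imset //=.
rewrite -sumrB (big_setID S') /= addrC big1 ?add0r => [|a]; last first.
  case/setDP=> Na nSa; rewrite (vfix_transport dX Sd sSP stX Sd' sSP' Fg) ?subrr //.
rewrite (setIidPr _) // (eq_bigr (fun _ => vmark X (S, d) - vmark X (S', d'))%R).
  by rewrite sumr_const mulr_natl.
move=> a Sa; rewrite !vfix_id //.
by rewrite -gS imset_f.
Qed.

End Stabilise.

(** * Construction of an F-stable decorated set *)

Section StabiliseExists.

Variables (gT : finGroupType) (p : nat) (P Q : {group gT}) (F : fusion_system P).
Variable lam : gT -> 'F_p.
Hypothesis nsQP : Q <| P.
Hypothesis lamM : {in Q &, forall x y, lam (x * y) = (lam x + lam y)%R}.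
Hypothesis lamJ : {in Q & P, forall x u, lam (x ^ u) = lam x}.
Hypothesis innQ : forall R f, F R P f -> inner_mod P Q R f.
Hypothesis satF : saturated F p.
Hypothesis pP : p.-group P.

Implicit Types (R S T : {group gT}) (f g : gT -> gT).
Notation deco := {ffun gT -> 'F_p}.
Implicit Types (c d e : deco).
Notation decoration := (decoration Q lam).
Notation pull := (pull Q).
Notation orbit_points := (orbit_points P Q).
Notation deco_norm := (deco_norm P Q).
Notation vmark := (vmark P Q).
Notation stable_at := (stable_at Q F).
Notation pair := ({group gT} * deco)%type.
Implicit Types (X : virtual_set gT p) (u v w : pair).

Lemma orbit_points_card_le R c S d C : R \subset P -> decoration R c ->
  C \in orbit_points (R, c) (S, d) -> #|S| <= #|R|.
Proof.
move=> sRP Rc CX; have [x Px eqC] := orbit_points_coset CX.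
rewrite {}eqC in CX; have /(orbit_pointsP nsQP lamJ _ _ sRP Rc Px)[sSR _] := CX.
by rewrite -(cardJg S x^-1) subset_leq_card.
Qed.

Lemma orbit_points_conj R c S d y : R \subset P -> decoration R c -> y \in P ->
  #|orbit_points (R, c) (S, pull S (conjg^~ y) d)| = #|orbit_points (R, c) ((S :^ y)%G, d)|.
Proof.
move=> sRP Rc Py; rewrite -(card_imset _ (act_inj 'Rs y)); apply: eq_card => C.
have eqv x : x \in P -> (R :* x \in orbit_points (R, c) (S, pull S (conjg^~ y) d)) =
                        (R :* (x * y) \in orbit_points (R, c) ((S :^ y)%G, d)).
  move=> Px; have Pxy := groupM Px Py.
  apply/(orbit_pointsP nsQP lamJ _ _ sRP Rc Px)/(orbit_pointsP nsQP lamJ _ _ sRP Rc Pxy);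
  rewrite /= invMg conjsgM conjsgK => -[sSR cd]; split=> // s Ss.
    have /setIP[/imsetP[t St ->] Qs] := Ss.
    have Qt : t \in Q by rewrite -(memJ_norm _ (subsetP (normal_norm nsQP) y Py)).
    by rewrite conjgM conjgK cd ?inE ?St // pullE // inE St.
  rewrite pullE //= -cd; first by rewrite conjgM conjgK.
  have /setIP[Ss' Qs] := Ss; rewrite inE memJ_conjg Ss' /=.
  by rewrite memJ_norm // (subsetP (normal_norm nsQP)).
apply/imsetP/idP=> [[D DX ->] | CX].
  have [x Px eqD] := orbit_points_coset DX; rewrite eqD in DX *.
  by rewrite /= rcosetE -rcosetM -eqv.
have [x Px eqC] := orbit_points_coset CX; rewrite eqC in CX *.
exists (R :* (x * y^-1)); last by rewrite /= rcosetE -rcosetM mulgKV.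
by rewrite eqv ?groupM ?groupV // mulgKV.
Qed.

Lemma orbit_points_self S d : S \subset P -> decoration S d ->
  #|orbit_points (S, d) (S, d)| = #|deco_norm S d : S|.
Proof.
move=> sSP Sd; congr #|pred_of_set _|; apply/setP=> C.
have sNP : deco_norm S d \subset P by apply/subsetP=> a /deco_normP[/setIP[]].
have eqv x : x \in P -> (S :* x \in orbit_points (S, d) (S, d)) = (x \in deco_norm S d).
  move=> Px; rewrite -[RHS](groupV (deco_norm_group nsQP S d)).
  apply/(orbit_pointsP nsQP lamJ _ _ sSP Sd Px)/deco_normP=> -[nS dx]; split=> //.
    by rewrite inE groupV Px inE.
  by have /setIP[_] := nS; rewrite inE.
apply/idP/rcosetsP=> [CX | [x Nx ->]]; last by rewrite eqv // (subsetP sNP).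
have [x Px eqC] := orbit_points_coset CX; exists x => //.
by rewrite -eqv // -eqC.
Qed.

Definition deco_stab S d : {set {perm gT}} :=
  [set a in AutF F S | [forall s in S :&: Q, d (a s) == d s]].

Lemma deco_stabP S d (a : {perm gT}) :
  reflect (a \in AutF F S /\ {in S :&: Q, forall s, d (a s) = d s})
          (a \in deco_stab S d).
Proof. by apply: (iffP setIdP) => [] [Aa /eqfun_inP]. Qed.

Let AutF_memIQ S (a : {perm gT}) s : a \in AutF F S -> s \in S :&: Q -> a s \in S :&: Q.
Proof. by move/AutF_fiso/fisoW => Fa; apply: (fhom_memIQ nsQP innQ Fa). Qed.

Lemma deco_stab_group_set S d : S \subset P -> group_set (deco_stab S d).
Proof.
move=> sSP; have /group_setP[A1 AM] := AutF_group_set F sSP.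
apply/group_setP; split=> [|a b /deco_stabP[Aa ad] /deco_stabP[Ab bd]].
  by apply/deco_stabP; split=> // s _; rewrite perm1.
apply/deco_stabP; split=> [|s Ss]; first exact: AM.
by rewrite permM bd ?ad ?AutF_memIQ.
Qed.

(* The analogue for decorated subgroups of being fully normalised.            *)
Definition nice u := [/\ u.1 \subset P, decoration u.1 u.2, fully_normalized F u.1
  & p.-Sylow(deco_stab u.1 u.2) (AutP P u.1 :&: deco_stab u.1 u.2)].

(** The twist produced by [sylow_extend] lies in the stabiliser of [d], so [g] may differ from [f]
    on S' but pulls [d] back to the same decoration. *)
Lemma nice_extend S d S' f : nice (S, d) -> fiso F S' S f ->
  exists g, [/\ F (deco_norm_group nsQP S' (pull S' f d)) P g, g @: S' = S
              & pull S' g d = pull S' f d].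
Proof.
case=> /= sSP Sd fnS sylS isof; set d' := pull S' f d.
have Ff := fisoW isof; have [sSP' _] := fhom_obj Ff.
have Sd' : decoration S' d' := pull_decoration nsQP lamM lamJ innQ Ff Sd.
have [|||b [g Bb [Fg gE]]] := sylow_extend (B := Group (deco_stab_group_set d sSP))
   (N := deco_norm_group nsQP S' d') satF pP fnS _ sylS isof.
- by apply/subsetP=> a /deco_stabP[].
- by apply/subsetP=> a /deco_normP[].
- move=> a /deco_normP[Na ad].
  have Aa : conj_aut S' a \in AutF F S'.
    by apply: (subsetP (AutP_sub_AutF F sSP')); apply: mem_AutP.
  have nSa : a \in 'N(S') by case/setIP: Na.
  have [b Ab bE] := AutF_conjP isof Aa.
  have bE' : {in S', forall x, b (f x) = f (x ^ a)}.
    by move=> x Sx; rewrite bE ?norm_conj_autE.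
  exists b => //; apply/deco_stabP; split=> // y /setIP[].
  rewrite -{1}(fiso_im isof) => /imsetP[x Sx ->].
  rewrite (fhom_memQ nsQP innQ Ff) // => Qx.
  have SQx : x \in S' :&: Q by rewrite inE Sx.
  have := ad x SQx; rewrite !ffunE SQx (memJ_normIQ nsQP) // SQx bE' //.
have /deco_stabP[Ab bd] := Bb.
exists g; split=> //.
  by rewrite (eq_in_imset gE) imset_comp (fiso_im isof) (fiso_im (AutF_fiso Ab)).
apply/ffunP=> x; rewrite !ffunE; case: ifP => // SQx.
rewrite gE /=; last by case/setIP: SQx.
by rewrite bd // (fhom_memIQ nsQP innQ Ff).
Qed.

Definition fusion_conj v u : bool :=
  [exists f : {ffun gT -> gT}, fiso F v.1 u.1 f && (v.2 == pull v.1 f u.2)].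

Lemma fusion_conjP v u :
  reflect (exists2 f, fiso F v.1 u.1 f & v.2 = pull v.1 f u.2) (fusion_conj v u).
Proof.
apply: (iffP existsP) => [[f /andP[isof /eqP vE]] | [f isof vE]]; first by exists f.
exists (finfun f); rewrite (@eq_fiso _ _ _ _ _ _ f) ?isof; last by move=> x _; rewrite ffunE.
by rewrite vE; apply/eqP/eq_pull => x _; rewrite ffunE.
Qed.

Lemma fusion_conj_trans v u w : fusion_conj v u -> fusion_conj u w -> fusion_conj v w.
Proof.
case/fusion_conjP=> f isof vE /fusion_conjP[g isog uE].
apply/fusion_conjP; exists (g \o f); first exact: fiso_comp isof isog.
by rewrite vE uE (pull_comp nsQP innQ _ (fisoW isof) (fisoW isog)).
Qed.

Lemma fusion_conj_sym v u : decoration u.1 u.2 -> fusion_conj v u -> fusion_conj u v.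
Proof.
move=> ud /fusion_conjP[f isof vE]; have [g isog [fK gK]] := fiso_inv isof.
apply/fusion_conjP; exists g => //.
rewrite vE (pull_comp nsQP innQ _ (fisoW isog) (fisoW isof)) -[LHS](pull_id ud).
by apply: eq_pull => x /setIP[Sx _] /=; rewrite gK.
Qed.

Lemma fusion_conj_valid v u : fusion_conj v u -> decoration u.1 u.2 ->
  [/\ v.1 \subset P, decoration v.1 v.2 & #|v.1| = #|u.1|].
Proof.
case/fusion_conjP=> f isof -> ud; split; last exact: fiso_card isof.
  by have [] := fhom_obj (fisoW isof).
exact: (pull_decoration nsQP lamM lamJ innQ (fisoW isof) ud).
Qed.

(** Move the decoration to a fully normalized S, then twist it by an automorphism [a] of S that
    conjugates a Sylow subgroup [T] of its stabiliser into Aut_P(S). The new stabiliser is the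
    conjugate by [a], and it meets Aut_P(S) in T :^ a. *)
Lemma exists_nice v : v.1 \subset P -> decoration v.1 v.2 ->
  exists2 u, nice u & fusion_conj v u.
Proof.
case: v => R c /= sRP Rc; have [S [h isoh fnS]] := exists_fully_normalized F sRP.
have [_ sSP] := fiso_sub isoh; have [h' isoh' [hK h'K]] := fiso_inv isoh.
pose d0 := pull S h' c.
have Sd0 : decoration S d0 := pull_decoration nsQP lamM lamJ innQ (fisoW isoh') Rc.
pose A := Group (AutF_group_set F sSP).
pose B0 := Group (deco_stab_group_set d0 sSP).
have sBA : B0 \subset A by apply/subsetP=> b /deco_stabP[].
have [T sylT] := Sylow_exists p B0.
have [sTB pT _] := and3P sylT.
have sylA : p.-Sylow(A) (conj_aut S @* 'N_P(S))%G := (satF.1 S sSP fnS).2.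
have [a Aa sTa] := Sylow_Jsub sylA (subset_trans sTB sBA) pT.
have Aa' : a^-1 \in A by rewrite groupV.
pose d := pull S a^-1 d0.
have Sd : decoration S d := pull_decoration nsQP lamM lamJ innQ (fisoW (AutF_fiso Aa')) Sd0.
have dE : {in S :&: Q, forall s, d (a s) = d0 s}.
  by move=> s Ss; rewrite pullE ?AutF_memIQ //= permK.
have d0E b s : b \in A -> s \in S :&: Q -> d0 ((b ^ a^-1) s) = d (b (a s)).
  move=> Ab Ss; have Sas := AutF_memIQ Aa Ss.
  by rewrite [RHS]pullE ?AutF_memIQ //= conjgE invgK !permM.
have stE : deco_stab S d = B0 :^ a.
  apply/setP=> b; rewrite mem_conjg.
  have eqA : (b ^ a^-1 \in A) = (b \in A) by rewrite (groupJr _ Aa').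
  apply/deco_stabP/deco_stabP=> -[Ab bd].
    split=> [|s Ss]; first by rewrite [_ \in _]eqA.
    by rewrite d0E // bd ?dE ?AutF_memIQ.
  have {}Ab : b \in A by rewrite -eqA.
  split=> // s Ss; have Ss' := AutF_memIQ Aa' Ss.
  by rewrite -[s](permKV a) -d0E // bd // dE.
exists (S, d); last first.
  have ud : fusion_conj (S, d) (R, c).
    apply: (@fusion_conj_trans _ (S, d0)); apply/fusion_conjP.
      by exists a^-1%g => //; apply: AutF_fiso.
    by exists h'.
  exact: fusion_conj_sym ud.
split=> //=; rewrite stE; set I := AutP P S :&: _.
have sTI : T :^ a \subset I by rewrite subsetI sTa conjSg.
have sylTa : p.-Sylow(B0 :^ a) (T :^ a) by rewrite pHallJ2.
have pI : p.-group I.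
  apply: pgroupS (subsetIl _ _) _; apply: morphim_pgroup.
  exact: pgroupS (subsetIl _ _) pP.
have eqI : I = T :^ a.
  pose J := ((conj_aut S @* 'N_P(S)) :&: B0 :^ a)%G.
  exact: (@sub_pHall _ p _ _ J sylTa pI sTI (subsetIr _ _)).
by rewrite eqI.
Qed.

End StabiliseExists.

(** * Stabilising the marks level by level *)

Section StabiliseLoop.

Variables (gT : finGroupType) (p : nat) (P Q : {group gT}) (F : fusion_system P).
Variable lam : gT -> 'F_p.
Hypothesis p_pr : prime p.
Hypothesis nsQP : Q <| P.
Hypothesis lamM : {in Q &, forall x y, lam (x * y) = (lam x + lam y)%R}.
Hypothesis lamJ : {in Q & P, forall x u, lam (x ^ u) = lam x}.
Hypothesis innQ : forall R f, F R P f -> inner_mod P Q R f.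
Hypothesis satF : saturated F p.
Hypothesis pP : p.-group P.

Implicit Types (R S T : {group gT}) (f g : gT -> gT).
Notation deco := {ffun gT -> 'F_p}.
Implicit Types (c d e : deco).
Notation decoration := (decoration Q lam).
Notation pull := (pull Q).
Notation orbit_points := (orbit_points P Q).
Notation deco_norm := (deco_norm P Q).
Notation vmark := (vmark P Q).
Notation stable_at := (stable_at Q F).
Notation decorated := (decorated P Q lam).
Notation fusion_conj := (fusion_conj Q F).
Notation nice := (nice Q F lam).
Notation pair := ({group gT} * deco)%type.
Implicit Types (X : virtual_set gT p) (u v w : pair).

Definition valid u := (u.1 \subset P) && decoration u.1 u.2.

(** The degree of the underlying virtual P-set, modulo p. *)
Definition vsize X : 'F_p := (\sum_(i <- X) i.2%:~R * #|P : i.1.1|%:R)%R.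

Lemma stable_conj X u v : stable_at X u -> fusion_conj v u -> vmark X v = vmark X u.
Proof.
move=> stu /(fusion_conjP Q F v u)[f isof].
by case: v isof => S c /= isof ->; apply: stu.
Qed.

Lemma conj_stable X u : (forall v, fusion_conj v u -> vmark X v = vmark X u) -> stable_at X u.
Proof.
move=> eqX S' f isof; apply: eqX; apply/(fusion_conjP Q F).
by exists f.
Qed.

(** The index is the mark at [v] of the orbit [v] itself ([orbit_points_self]), so adding [k] copies
    of that orbit makes the marks at [u] and [v] agree. *)
Lemma vmark_diff_dvd X v u : decorated X -> valid v -> nice u -> fusion_conj v u ->
    (forall w, valid w -> #|u.1| < #|w.1| -> stable_at X w) ->
  exists k : int, (vmark X u - vmark X v = k * #|deco_norm v.1 v.2 : v.1|%:R)%R.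
Proof.
case: v u => S' d' [S d] dX /andP[/= sSP' Sd'] niceu /(fusion_conjP Q F)[f /= isof d'E] stX.
have [g [Fg gS gE]] := nice_extend nsQP lamM lamJ innQ satF pP niceu isof.
have [/= sSP Sd _ _] := niceu.
have stX' T e : decoration T e -> #|S| < #|T| -> stable_at X (T, e).
  move=> Te ltST; have [sTP | nTP] := boolP (T \subset P).
    by apply: stX; rewrite // /valid sTP.
  by move=> S1 f1 /fisoW/fhom_obj[_ sTP]; rewrite sTP in nTP.
have dvd := @vmark_congr _ _ _ _ _ _ nsQP lamM lamJ innQ X S S' d g dX Sd sSP stX'.
rewrite -d'E in gE Fg; rewrite gE in dvd; have {dvd} := dvd Sd' sSP' Fg gS.
rewrite -(@Lagrange _ (deco_norm_group nsQP S' d') S'); last exact: (sub_deco_norm nsQP lamJ).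
rewrite PoszM natz dvdz_mul2l -?lt0n ?cardG_gt0 // => /dvdzP[k kE].
by exists k; rewrite kE natz.
Qed.

Lemma vmark_cons i X u : vmark (i :: X) u = (i.2 * #|orbit_points i.1 u|%:R + vmark X u)%R.
Proof. exact: big_cons. Qed.

Lemma vsize_cons i X : vsize (i :: X) = (i.2%:~R * #|P : i.1.1|%:R + vsize X)%R.
Proof. exact: big_cons. Qed.

Lemma index_proper_Fp R : R \proper P -> (#|P : R|%:R = 0 :> 'F_p)%R.
Proof.
move=> prR; apply/eqP; rewrite -(dvdn_pcharf (pchar_Fp p_pr)).
have /p_natP[n En] := pnat_dvd (dvdn_indexg P R) pP.
rewrite En; case: n En => [|n] En; last by rewrite expnS dvdn_mulr.
by have /eqP := En; rewrite expn0 indexg_eq1 => sPR; case/negP: (proper_subn prR).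
Qed.

(** Among pairs of its own order, an orbit is seen only by its P-conjugates; a correction at [v]
    therefore changes no other P-class of that order. *)
Lemma orbit_points_same_order v w : valid v -> #|v.1| = #|w.1| -> #|orbit_points v w| != 0%N ->
    decoration w.1 w.2 ->
  #|orbit_points v w| = #|deco_norm v.1 v.2 : v.1| /\
  exists2 y, y \in P &
    w.1 = v.1 :^ y :> {set gT} /\ v.2 = pull v.1 (conjg^~ y) w.2.
Proof.
case: v w => R c [S d] /andP[/= sRP Rc] /= eqRS; rewrite cards_eq0 => /set0Pn[C CX] Sd.
have [x Px eqC] := orbit_points_coset CX; rewrite eqC in CX *.
have /(orbit_pointsP nsQP lamJ _ _ sRP Rc Px)[sSR cd] := CX.
have eqSR : S :^ x^-1 = R.
  by apply/eqP; rewrite eqEcard sSR cardJg eqRS leqnn.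
have eqS : S = (R :^ x)%G.
  by apply/val_inj; rewrite /= -eqSR conjsgKV.
have cE : c = pull R (conjg^~ x) d.
  apply/ffunP=> s; rewrite ffunE; case: ifPn => [Rs|nRs]; last by have /decorationP[_ ->] := Rc.
  rewrite -cd ?conjgK // eqS; have /setIP[Rs' Qs] := Rs.
  by rewrite inE memJ_conjg Rs' memJ_norm // (subsetP (normal_norm nsQP)).
split; last by exists x => //; rewrite eqS.
rewrite [in LHS]eqS -(orbit_points_conj nsQP lamJ _ _ sRP Rc Px) -cE.
exact: (orbit_points_self nsQP lamJ).
Qed.

Lemma vmark_conj X R y d : decorated X -> y \in P ->
  vmark X ((R :^ y)%G, d) = vmark X (R, pull R (conjg^~ y) d).
Proof.
move=> dX Py; rewrite /vmark; apply: eq_big_seq => -[[S c] n] /= Xi.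
have /andP[/= sSP Sc] := allP dX _ Xi.
congr (_ * _%:R)%R; apply: esym.
exact: (orbit_points_conj nsQP lamJ R d sSP Sc Py).
Qed.

Section Level.

Variable n : nat.
Hypothesis ltnP : n < #|P|.

Definition good X := decorated X /\ vsize X = 1%R.

(** The mark at the nice pair [u] is the target for its whole class. At order [n] a mark is either
    untouched or already at the target, so corrections neither undo one another nor move the mark at
    [u]. *)
Lemma fix_class X0 u : good X0 -> nice u -> #|u.1| = n ->
    (forall w, valid w -> n < #|w.1| -> stable_at X0 w) ->
  forall L : seq pair, exists X, [/\ good X,
    forall w, valid w -> n < #|w.1| -> vmark X w = vmark X0 w,
    forall w, valid w -> #|w.1| = n ->
      vmark X w = vmark X0 w \/ fusion_conj w u /\ vmark X w = vmark X0 u &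
    forall w, w \in L -> valid w -> fusion_conj w u -> vmark X w = vmark X0 u].
Proof.
move=> goodX0 niceu un stX0; elim=> [|v L [X [goodX bigX eqX LX]]].
  by exists X0; split=> // w _ _; left.
have [vu | nvu] := boolP (fusion_conj v u && (vmark X v != vmark X0 u)); last first.
  exists X; split=> // w; rewrite inE => /predU1P[-> _ vu | /LX//].
  by move: nvu; rewrite vu negbK => /eqP.
have {vu}/andP[vu neqX] := vu; have [usP ud _ _] := niceu.
have [vsP vd vn] := fusion_conj_valid nsQP lamM lamJ innQ vu ud.
have val_v : valid v by apply/andP. have val_u : valid u by apply/andP.
have Xu : vmark X u = vmark X0 u by case: (eqX u val_u un) => // -[].
have [dX sX] := goodX.
have stX w : valid w -> #|u.1| < #|w.1| -> stable_at X w.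
  rewrite un => val_w ltw; apply: conj_stable => w' w'w.
  have [_ wd] := andP val_w.
  have [w'P w'd w'n] := fusion_conj_valid nsQP lamM lamJ innQ w'w wd.
  rewrite !bigX // ?w'n //; last exact/andP.
  exact: stable_conj (stX0 w val_w ltw) w'w.
have [k kE] := vmark_diff_dvd dX val_v niceu vu stX.
pose X' := (v, k) :: X.
have X'E w : valid w -> #|w.1| = n -> vmark X' w = vmark X w \/
    fusion_conj w u /\ vmark X' w = vmark X0 u.
  move=> val_w wn; rewrite vmark_cons /=; have [sw wd] := andP val_w.
  have [-> | nz] := eqVneq #|orbit_points v w| 0%N; first by left; rewrite mulr0 add0r.
  have [-> [y Py [wE vE]]] := orbit_points_same_order val_v (etrans vn (etrans un (esym wn))) nz wd.
  have wE' : w = ((v.1 :^ y)%G, w.2).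
    by case: (w) wE => w1 w2 /= w1E; congr (_, _); apply: val_inj.
  right; split.
    apply: fusion_conj_trans vu => //.
    apply: (fusion_conj_sym nsQP innQ wd); apply/(fusion_conjP Q F).
    by rewrite vE; exists (conjg^~ y); rewrite // wE'; apply: fiso_conj.
  rewrite wE' vmark_conj // -vE -kE -surjective_pairing -Xu.
  by rewrite subrK.
exists X'; split.
- split; first by rewrite /= dX andbT.
  rewrite vsize_cons /= index_proper_Fp ?mulr0 ?add0r //.
  by rewrite properEcard vsP vn un.
- move=> w val_w ltw; rewrite vmark_cons /= -bigX //.
  have -> : #|orbit_points v w| = 0%N; last by rewrite mulr0 add0r.
  apply/eqP; rewrite cards_eq0; apply: contraTT ltw => /set0Pn[C CX].
  rewrite -leqNgt -un -vn; case: (v) (w) CX vsP vd => [R c] [S d] /= CX vsP vd.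
  exact: (orbit_points_card_le nsQP lamJ vsP vd CX).
- move=> w val_w wn; case: (X'E w val_w wn) => [-> | ?]; last by right.
  exact: eqX.
move=> w; rewrite inE => /predU1P[-> | Lw] val_w wu.
  rewrite vmark_cons /= {1}[v in orbit_points v v]surjective_pairing.
  rewrite (surjective_pairing v) /= (orbit_points_self nsQP lamJ) // -surjective_pairing.
  by rewrite -kE subrK.
have [_ _ wn'] := fusion_conj_valid nsQP lamM lamJ innQ wu ud.
case: (X'E w val_w (etrans wn' un)) => [-> | [] //].
exact: LX.
Qed.

Lemma fix_level X0 : good X0 ->
    (forall w, valid w -> n < #|w.1| -> stable_at X0 w) ->
  forall L : seq pair, exists X, [/\ good X,
    forall w, valid w -> n < #|w.1| -> stable_at X w &
    forall w, w \in L -> valid w -> #|w.1| = n -> stable_at X w].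
Proof.
move=> goodX0 stX0; elim=> [|v L [X [goodX bigX LX]]]; first by exists X0; split.
have [/andP[val_v /eqP vn] | nv] := boolP (valid v && (#|v.1| == n)); last first.
  exists X; split=> // w; rewrite inE => /predU1P[-> val_v vn | /LX//].
  by rewrite val_v vn eqxx in nv.
have /andP[vsP vd] := val_v.
have [u niceu vu] := exists_nice nsQP lamM lamJ innQ satF pP vsP vd.
have [usP ud _ _] := niceu.
have uv := fusion_conj_sym nsQP innQ ud vu.
have [_ _ un] := fusion_conj_valid nsQP lamM lamJ innQ uv vd.
rewrite vn in un.
have [X' [goodX' bigX' eqX' allX']] := fix_class goodX niceu un bigX (enum [set: pair]).
have classX' w : valid w -> fusion_conj w u -> stable_at X' w.
  move=> val_w wu; apply: conj_stable => w' w'w; have [_ wd] := andP val_w.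
  have [w'P w'd w'n] := fusion_conj_valid nsQP lamM lamJ innQ w'w wd.
  have w'u := fusion_conj_trans nsQP innQ w'w wu.
  by rewrite !allX' ?mem_enum ?inE //; apply/andP.
exists X'; split=> // [w val_w ltw | w].
  apply: conj_stable => w' w'w; have [_ wd] := andP val_w.
  have [w'P w'd w'n] := fusion_conj_valid nsQP lamM lamJ innQ w'w wd.
  rewrite !bigX' ?w'n //; last exact/andP.
  exact: stable_conj (bigX w val_w ltw) w'w.
rewrite inE => /predU1P[-> | Lw] val_w wn; first exact: classX'.
have [wu | nwu] := boolP (fusion_conj w u); first exact: classX'.
apply: conj_stable => w' w'w; have [_ wd] := andP val_w.
have [w'P w'd w'n] := fusion_conj_valid nsQP lamM lamJ innQ w'w wd.
have nw'u : ~~ fusion_conj w' u.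
  apply: contra nwu => w'u.
  exact: fusion_conj_trans (fusion_conj_sym nsQP innQ wd w'w) w'u.
have eqm x : valid x -> #|x.1| = n -> ~~ fusion_conj x u -> vmark X' x = vmark X x.
  by move=> val_x xn nxu; case: (eqX' x val_x xn) => // -[]; rewrite (negPf nxu).
rewrite !eqm // ?w'n //; last exact/andP.
exact: stable_conj (LX w Lw val_w wn) w'w.
Qed.

End Level.

Hypothesis sQPhi : Q \subset 'Phi(P).

(* The initial one-point orbit is stable at P since homomorphisms P -> F_p    *)
(* vanish on Q, so that P has only one decoration.                            *)
Lemma exists_stable : exists2 X, good X & forall w, valid w -> stable_at X w.
Proof.
suff level m : exists2 X, good X & forall w, valid w -> #|P| <= m + #|w.1| -> stable_at X w.
  by have [X gX stX] := level #|P|; exists X => // w vw; apply: stX; rewrite ?leq_addr.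
elim: m => [|m [X gX stX]].
  pose d0 : deco := pull P id (finfun lam).
  have P0 : decoration P d0.
    apply/decorationP; split=> [|x nx]; last by rewrite ffunE (negPf nx).
    exists (fun=> 0%R) => [x y _ _ | x Px]; first by rewrite addr0.
    by rewrite pullE //= ffunE addr0.
  have uniqP d : decoration P d -> d = d0.
    case/decorationP=> -[k kM dk] dN; apply/ffunP=> x; rewrite /d0 !ffunE.
    case: ifPn => [Px | /dN//]; rewrite dk //.
    have /setIP[_ /(subsetP sQPhi) Phix] := Px.
    by rewrite [k x](morph_Phi_Fp p_pr pP (Morphism kM) Phix) addr0.
  exists [:: ((P, d0), 1%R)].
    split; first by rewrite /= subxx P0.
    by rewrite /vsize big_seq1 /= indexgg mulr1.
  case=> S d /andP[/= sSP Sd]; rewrite add0n => leP.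
  have eqSP : S = P by apply/val_inj/eqP; rewrite /= eqEcard sSP.
  rewrite eqSP in Sd *; apply: conj_stable => -[S' d'] vu.
  have [/= sSP' Sd' cardS'] := fusion_conj_valid nsQP lamM lamJ innQ vu Sd.
  have eqSP' : S' = P by apply/val_inj/eqP; rewrite /= eqEcard sSP' cardS' /=.
  by rewrite eqSP' in Sd' *; rewrite (uniqP _ Sd) (uniqP _ Sd').
have [lemP | ltPm] := leqP #|P| m.
  by exists X => // w vw _; apply: stX => //; apply: leq_trans lemP (leq_addr _ _).
have ltnP : #|P| - m.+1 < #|P| by rewrite ltn_subrL cardG_gt0.
have [|X' [gX' bigX' levX']] := fix_level ltnP gX _ (enum [set: pair]).
  by move=> w vw lt; apply: stX => //; rewrite ltn_subLR // ltnS in lt.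
exists X' => // w vw lew.
have : #|P| - m.+1 <= #|w.1| by rewrite leq_subLR.
rewrite leq_eqVlt => /predU1P[eqw | ltw]; last exact: bigX'.
by apply: levX'; rewrite ?mem_enum ?inE.
Qed.

End StabiliseLoop.

(** * Transfer of a decorated set *)

Section Evaluation.

Variables (gT : finGroupType) (p : nat) (P Q : {group gT}).
Variable lam : gT -> 'F_p.
Hypothesis p_pr : prime p.
Hypothesis pP : p.-group P.
Hypothesis nsQP : Q <| P.
Hypothesis lamM : {in Q &, forall x y, lam (x * y) = (lam x + lam y)%R}.
Hypothesis lamJ : {in Q & P, forall x u, lam (x ^ u) = lam x}.
Hypothesis sQPhi : Q \subset 'Phi(P).

Implicit Types (R S T : {group gT}).
Notation deco := {ffun gT -> 'F_p}.
Implicit Types (c d e : deco).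
Notation decoration := (decoration Q lam).
Notation pull := (pull Q).
Notation orbit_points := (orbit_points P Q).

Let memQJ x u : u \in P -> (x ^ u \in Q) = (x \in Q).
Proof. by move=> Pu; rewrite memJ_norm // (subsetP (normal_norm nsQP)). Qed.

Lemma lamX x n : x \in Q -> lam (x ^+ n) = (lam x *+ n)%R.
Proof.
move=> Qx; elim: n => [|n IHn].
  by apply: (@addrI _ (lam 1)); rewrite -lamM ?group1 // mulg1 addr0.
by rewrite expgS lamM ?groupX // IHn mulrS.
Qed.

Lemma decoM R c : decoration R c -> {in R :&: Q &, forall x y, c (x * y) = (c x + c y)%R}.
Proof.
case/decorationP=> -[k kM ck] _ x y Rx Ry.
rewrite !ck ?groupM // lamM ?kM //; try by [case/setIP: Rx | case/setIP: Ry].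
by rewrite addrACA.
Qed.

Lemma decoX R c x n : decoration R c -> x \in R :&: Q -> c (x ^+ n) = (c x *+ n)%R.
Proof.
move=> /decoM cM Rx; elim: n => [|n IHn].
  by apply: (@addrI _ (c 1)); rewrite -cM ?group1 // mulg1 addr0.
by rewrite expgS cM ?groupX // IHn mulrS.
Qed.

Section Orbit.

Variables (R : {group gT}) (c : deco).
Hypothesis sRP : R \subset P.
Hypothesis Rc : decoration R c.

(** Decoration values are lifted to integers, so that a factor p ^ N can be cancelled later. For [g]
    in Q the choice of [repr C] is immaterial ([weightE]). *)
Definition weight g (C : {set gT}) : nat :=
  if g ^ (repr C)^-1 \in R then val (c (g ^ (repr C)^-1)) else 0%N.

Lemma weightE g x : x \in P -> g \in Q ->
  weight g (R :* x) = if g ^ x^-1 \in R then val (c (g ^ x^-1)) else 0%N.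
Proof.
move=> Px Qg; rewrite /weight; case: repr_rcosetP => r Rr.
have Rr' : r^-1 \in R by rewrite groupV.
rewrite invMg conjgM groupJr //; case: ifP => // Rg.
congr (val _); apply: (decoJ nsQP lamJ sRP Rc) => //.
by rewrite inE Rg memQJ ?groupV.
Qed.

(** Each point fixed by [g] carries exactly one decoration of <[g]>. *)
Lemma sum_orbit_points g : g \in Q ->
  (\sum_(e | decoration <[g]>%G e) val (e g) * #|orbit_points (R, c) (<[g]>%G, e)|
   = \sum_(C in rcosets R P) weight g C)%N.
Proof.
move=> Qg; have Pg : g \in P := subsetP (normal_sub nsQP) g Qg.
have gg : g \in <[g]> :&: Q by rewrite inE cycle_id.
transitivity (\sum_(e | decoration <[g]>%G e) \sum_(C in rcosets R P)
   val (e g) * (C \in orbit_points (R, c) (<[g]>%G, e)))%N.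
  apply: eq_bigr => e _; rewrite -big_distrr -sum1_card /=; congr (_ * _)%N.
  rewrite big_mkcond [RHS]big_mkcond; apply: eq_bigr => C _.
  by case: (boolP (C \in orbit_points _ _)) => [/setIdP[-> _] | _] //; case: ifP.
rewrite exchange_big; apply: eq_bigr => _ /rcosetsP[x Px ->].
rewrite weightE //; case: ifPn => [Rg | nRg]; last first.
  apply: big1 => e _; case: (boolP (_ \in orbit_points _ _)) => [|_]; last by rewrite muln0.
  case/(orbit_pointsP nsQP lamJ _ _ sRP Rc Px)=> /subsetP/(_ (g ^ x^-1)).
  by rewrite memJ_conjg cycle_id => /(_ isT); rewrite (negPf nRg).
pose e0 := pull <[g]>%G (conjg^~ x^-1) c.
have sgR : <[g]> :^ x^-1 \subset R by rewrite -cycleJ cycle_subG.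
have e0E : {in <[g]> :&: Q, forall s, e0 s = c (s ^ x^-1)} by move=> s gs; rewrite pullE.
have e0P : decoration <[g]>%G e0 := decoration_conj nsQP lamJ Px sgR Rc.
have Ce0 : R :* x \in orbit_points (R, c) (<[g]>%G, e0).
  by apply/(orbit_pointsP nsQP lamJ _ _ sRP Rc Px); split=> // s gs; rewrite e0E.
rewrite (bigD1 e0) //= Ce0 muln1 big1 ?addn0 ?e0E // => e /andP[eP ne].
case: (boolP (_ \in orbit_points _ _)) => [|_]; last by rewrite muln0.
case/(orbit_pointsP nsQP lamJ _ _ sRP Rc Px)=> _ ce; case/eqP: ne.
apply/ffunP=> s; rewrite ffunE; case: ifPn => [gs | ngs]; first by rewrite ce.
by have /decorationP[_ ->] := eP.
Qed.

Variables (q : gT) (N : nat).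
Hypothesis Qq : q \in Q.
Hypothesis cardP : #|P| = (p ^ N)%N.
Let Pq : q \in P := subsetP (normal_sub nsQP) q Qq.
Local Notation n_ x := #|<[q]> : R :* x|%g.
Local Notation q_ i := (q ^+ (p ^ i)%N)%g.

(** [n_ x] is the length of the <[q]>-orbit of R x, and the hypothesis says that q ^+ k fixes this
    point. *)
Lemma index_cycle_dvd x k : (q ^+ k) ^ x^-1 \in R -> n_ x %| k.
Proof.
move=> Rqk; rewrite /indexg -orbitRs card_orbit ?subsetT //.
have stab : <[q ^+ k]> \subset 'C_<[q]>[R :* x | 'Rs].
  rewrite cycle_subG inE mem_cycle /=; apply/astab1P.
  rewrite /= rcosetE -rcosetM; apply/rcoset_eqP.
  by rewrite mem_rcoset; move: Rqk; rewrite conjgE invgK mulgA.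
apply: dvdn_trans (indexgS _ stab) _.
have eq_index : #|<[q]> : <[q ^+ k]>| = gcdn #[q] k.
  apply/eqP; rewrite -(eqn_pmul2l (order_gt0 (q ^+ k))) Lagrange ?cycleX //.
  by rewrite orderXgcd divnK ?dvdn_gcdl.
by rewrite eq_index dvdn_gcdr.
Qed.

Lemma index_cycle_log x : exists2 j, j <= N & n_ x = (p ^ j)%N.
Proof.
have dv : n_ x %| p ^ N.
  rewrite /indexg -orbitRs card_orbit ?subsetT // -cardP.
  apply: dvdn_trans (dvdn_indexg _ _) _.
  by apply: cardSg; rewrite cycle_subG.
by have /dvdn_pfactor := dv; move/(_ p_pr).
Qed.

Lemma index_cycle_mem x : (q ^+ n_ x) ^ x^-1 \in R.
Proof. by have := mulg_exp_card_rcosets R q x; rewrite mem_rcoset conjgE invgK mulgA. Qed.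

(* Only the term with p ^ i = n_ x survives: for smaller i the point is not   *)
(* fixed, and for larger i the value is a multiple of p in F_p.               *)
Lemma sum_weight x : x \in P ->
  (n_ x * \sum_(i < N.+1) p ^ (N - i) * weight (q_ i) (R :* x)
   = p ^ N * val (c ((q ^+ n_ x) ^ x^-1)%g))%N.
Proof.
move=> Px; have [j lejN nE] := index_cycle_log x.
have Rq := index_cycle_mem x.
have lejN1 : j < N.+1 by [].
rewrite (bigD1 (Ordinal lejN1)) //= weightE ?groupX // -nE Rq big1 => [|i ne_ij].
  by rewrite addn0 mulnA {1}nE -expnD subnKC.
rewrite weightE ?groupX //; case: ifPn => [Rqi|]; last by rewrite muln0.
have := index_cycle_dvd Rqi; rewrite nE dvdn_Pexp2l ?prime_gt1 // leq_eqVlt.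
case/predU1P=> [eq_ij | lt_ji]; first by case/eqP: ne_ij; apply: val_inj.
rewrite -(subnKC lt_ji) addSnnS expnD expgM -nE conjXg.
rewrite (decoX _ Rc); last by rewrite inE Rq memQJ ?groupV ?groupX.
by rewrite expnS mulrnA -(mulr_natr _ p) pchar_Fp_0 // mulr0 mul0rn muln0.
Qed.

(** Group the cosets into <[q]>-orbits. Powers of [q] commute with <[q]>, so the weight is constant
    on an orbit, and its length [n_ x] is the factor absorbed by [sum_weight]. *)
Lemma orbit_eval (X : {set gT}) : is_transversal X (rcosets R P :* <[q]>) P ->
  (\sum_(i < N.+1) p ^ (N - i) *
     (\sum_(e | decoration <[q_ i]>%G e)
         val (e (q_ i)) * #|orbit_points (R, c) (<[q_ i]>%G, e)|)
   = p ^ N * \sum_(x in X) val (c ((q ^+ n_ x) ^ x^-1)%g))%N.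
Proof.
move=> trX; have sXP : {subset X <= P} := subsetP (transversal_sub trX).
under [LHS]eq_bigr => i _ do rewrite sum_orbit_points ?groupX // big_distrr /=.
rewrite exchange_big /= big_distrr /=.
have acts : [acts <[q]>, on rcosets R P | 'Rs].
  by apply: subset_trans (actsRs_rcosets R P); rewrite cycle_subG.
rewrite (set_partition_big _ (orbit_partition acts)) /=.
rewrite -(rcosets_cycle_transversal trX) big_imset /=; last first.
  move=> x y Xx Xy /= eqxy; apply: (pblock_inj trX) => //.
  have [Px Py] := (sXP x Xx, sXP y Xy).
  have /andP[/and3P[_ tiX _] _] := trX.
  have PtR : R :* x * <[q]> \in rcosets R P :* <[q]>.
    by rewrite mem_mulg ?set11 // -rcosetE imset_f.
  rewrite !(def_pblock tiX PtR) //; last by rewrite -{1}[x]mulg1 mem_mulg ?rcoset_refl.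
  have: R :* y \in rcosets (R :* x) <[q]>.
    by rewrite eqxy; apply/rcosetsP; exists 1; rewrite ?mulg1 ?rcoset1.
  case/rcosetsP=> g qg eqy; have: y \in R :* x :* g by rewrite -eqy rcoset_refl.
  by case/rcosetP=> z Rz ->; rewrite mem_mulg.
apply: eq_bigr => x Xx; have Px := sXP x Xx.
rewrite -sum_weight // -sum_nat_const; apply: eq_bigr => _ /rcosetsP[g qg ->].
rewrite -rcosetM; have Pg : g \in P by apply: subsetP qg; rewrite cycle_subG.
have Pxg := groupM Px Pg; apply: eq_bigr => i _.
have Qqi : q_ i \in Q := groupX _ Qq.
rewrite !weightE // invMg conjgM.
have -> // : (q_ i) ^ g^-1 = q ^+ (p ^ i).
apply/conjg_fixP/commgP; have cqq := cycle_abelian q.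
by apply: (centsP cqq); rewrite ?groupV ?mem_cycle.
Qed.

(** Writing c = lam + k, the [lam] parts add up with total orbit length |P : R|, and the [k] parts
    form a transfer vanishing at [q]. *)
Lemma orbit_sum (X : {set gT}) : is_transversal X (rcosets R P :* <[q]>) P ->
  (((\sum_(x in X) val (c ((q ^+ n_ x) ^ x^-1)%g))%N)%:R = #|P : R|%:R * lam q :> 'F_p)%R.
Proof.
move=> trX; have sXP : {subset X <= P} := subsetP (transversal_sub trX).
have /decorationP[[k kM ck] _] := Rc.
have Phiq := subsetP sQPhi q Qq.
have tr0 := transfer_Phi_Fp p_pr pP sRP kM Phiq trX.
transitivity (\sum_(x in X) ((n_ x)%:R * lam q + k ((q ^+ n_ x) ^ x^-1)%g))%R.
  rewrite natr_sum; apply: eq_bigr => x Xx; rewrite natr_Zp ck; last first.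
    by rewrite inE index_cycle_mem memQJ ?groupV ?sXP ?groupX.
  by rewrite lamJ ?groupV ?sXP ?groupX // lamX // mulr_natl.
rewrite big_split /= tr0 addr0 -mulr_suml -natr_sum.
by rewrite (sum_index_rcosets_cycle sRP Pq trX).
Qed.

End Orbit.

End Evaluation.

(** * F-invariance of lam *)

Section Stable.

Variables (gT : finGroupType) (p : nat) (P Q : {group gT}) (F : fusion_system P).
Variable lam : gT -> 'F_p.
Hypothesis p_pr : prime p.
Hypothesis pP : p.-group P.
Hypothesis nsQP : Q <| P.
Hypothesis lamM : {in Q &, forall x y, lam (x * y) = (lam x + lam y)%R}.
Hypothesis lamJ : {in Q & P, forall x u, lam (x ^ u) = lam x}.
Hypothesis sQPhi : Q \subset 'Phi(P).
Hypothesis innQ : forall R f, F R P f -> inner_mod P Q R f.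
Hypothesis satF : saturated F p.

Notation deco := {ffun gT -> 'F_p}.
Notation decoration := (decoration Q lam).
Notation pull := (pull Q).
Notation orbit_points := (orbit_points P Q).
Notation vmark := (vmark P Q).
Implicit Types (X : virtual_set gT p) (e : deco).

(** The virtual sum, over the points fixed by [g], of the lifted values of their decorations at
    [g]. *)
Definition mark_sum X g : int :=
  (\sum_(e | decoration <[g]>%G e) (val (e g))%:R * vmark X (<[g]>%G, e))%R.

Lemma mark_sum_stable X R S f g :
    (forall u, valid P Q lam u -> stable_at Q F X u) -> F R S f -> g \in R :&: Q ->
  mark_sum X (f g) = mark_sum X g.
Proof.
move=> stX Ff /setIP[Rg Qg]; have [_ sSP] := fhom_obj Ff.
have sgR : <[g]>%G \subset R by rewrite cycle_subG.
have Pfg : f g \in P := subsetP sSP _ (fhom_mem Ff Rg).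
have isof : fiso F <[g]>%G <[f g]>%G f.
  apply: (im_fiso (fhom_subl sgR Ff)); have [mf _ _] := fhom_inj Ff.
  by rewrite -[LHS](morphimEsub (morphm_morphism mf)) //= morphim_cycle.
have [h isoh [fK hK]] := fiso_inv isof.
have Fg := fisoW isof; have Fh := fisoW isoh.
have Fd := pull_decoration nsQP lamM lamJ innQ Fg.
have Hd := pull_decoration nsQP lamM lamJ innQ Fh.
have pK e : decoration <[f g]>%G e -> pull <[f g]>%G h (pull <[g]>%G f e) = e.
  move=> eP; rewrite (pull_comp nsQP innQ _ Fh Fg) -[RHS](pull_id eP).
  by apply: eq_pull => x /setIP[gx _]; apply: hK.
have pK' e : decoration <[g]>%G e -> pull <[g]>%G f (pull <[f g]>%G h e) = e.
  move=> eP; rewrite (pull_comp nsQP innQ _ Fg Fh) -[RHS](pull_id eP).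
  by apply: eq_pull => x /setIP[gx _]; apply: fK.
rewrite /mark_sum [RHS](reindex_onto (pull <[g]>%G f) (pull <[f g]>%G h)) //=.
apply: eq_big => e; last first.
  move=> eP; rewrite pullE /=; last by rewrite inE cycle_id.
  have := stX (<[f g]>%G, e) _ _ _ isof; rewrite /= => -> //.
  by rewrite /valid /= cycle_subG Pfg.
apply/idP/andP=> [eP | [eP /eqP <-]]; last exact: Hd.
by rewrite Fd // pK.
Qed.

Lemma mark_sum_cons i X g : mark_sum (i :: X) g =
  (i.2 * (\sum_(e | decoration <[g]>%G e)
            val (e g) * #|orbit_points i.1 (<[g]>%G, e)|)%N%:R + mark_sum X g)%R.
Proof.
rewrite natr_sum mulr_sumr -big_split; apply: eq_bigr => e _ /=.
by rewrite vmark_cons mulrDr natrM mulrCA.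
Qed.

Lemma mark_sum_eval X q N : decorated P Q lam X -> q \in Q -> #|P| = (p ^ N)%N ->
  exists2 z : int,
    (\sum_(i < N.+1) (p ^ (N - i))%N%:R * mark_sum X (q ^+ (p ^ i)%N)%g = (p ^ N)%N%:R * z)%R
    & (z%:~R = vsize P X * lam q)%R.
Proof.
move=> dX Qq cardP; elim: X dX => [|[[R c] k] X IHX] /=.
  exists 0%R; last by rewrite /vsize big_nil mul0r.
  rewrite mulr0 big1 // => i _; rewrite /mark_sum /vmark big1 ?mulr0 // => e _.
  by rewrite big_nil mulr0.
case/andP=> /andP[sRP Rc] /IHX[z zE zlam].
have Pq := subsetP (normal_sub nsQP) q Qq.
have trX := transversalP (rcosets_cycle_partition sRP Pq).
have evR := orbit_eval p_pr nsQP lamM lamJ sRP Rc Qq cardP trX.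
have lamR := orbit_sum p_pr pP nsQP lamM lamJ sQPhi sRP Rc Qq trX.
set U := (\sum_(x in _) _)%N in evR lamR.
exists (k * U%:R + z)%R.
  rewrite mulrDr -zE mulrCA -natrM -evR natr_sum mulr_sumr -big_split /=.
  by apply: eq_bigr => i _; rewrite mark_sum_cons mulrDr natrM mulrCA.
by rewrite vsize_cons intrD intrM zlam mulrDl -mulrA -lamR mulrz_nat.
Qed.

Lemma lam_stable R f q : F R P f -> q \in R :&: Q -> lam (f q) = lam q.
Proof.
move=> Ff Rq; have [X [dX sX] stX] := exists_stable p_pr nsQP lamM lamJ innQ satF pP sQPhi.
have /p_natP[N cardP] := pP; have /setIP[Rq' Qq] := Rq.
have /setIP[_ Qfq] := fhom_memIQ nsQP innQ Ff Rq.
have [z1 z1E lam1] := mark_sum_eval dX Qq cardP.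
have [z2 z2E lam2] := mark_sum_eval dX Qfq cardP.
(* As the degree is 1, [lam] at [q] and at [f q] are the residues of [z1] and [z2]; these integers
   agree because their multiples by p ^ N do. *)
rewrite -[LHS]mul1r -[RHS]mul1r -sX -lam1 -lam2; congr (_%:~R)%R.
have pN0 : ((p ^ N)%N%:R != 0 :> int)%R by rewrite natz -lt0n expn_gt0 prime_gt0.
apply: (mulfI pN0); rewrite -z1E -z2E; apply: eq_bigr => i _; congr (_ * _)%R.
rewrite -(fhomX _ Ff) //; apply: (mark_sum_stable stX Ff).
by rewrite inE !groupX.
Qed.

End Stable.

(** * Descent from Phi(P) to 1 *)

Section Final.

Variables (gT : finGroupType) (p : nat) (P : {group gT}) (F : fusion_system P).
Hypothesis p_pr : prime p.
Hypothesis pP : p.-group P.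
Hypothesis satF : saturated F p.
Implicit Types (R S Q D : {group gT}) (f : gT -> gT).

(** A normal subgroup of order p of the p-group P / D is central; [lam] is the projection to Q / D
    followed by an isomorphism with F_p. *)
Lemma central_functional Q D : Q <| P -> D <| P -> D \subset Q -> #|Q : D| = p ->
  exists lam : gT -> 'F_p,
    [/\ {in Q &, forall x y, lam (x * y) = (lam x + lam y)%R},
        {in Q & P, forall x u, lam (x ^ u) = lam x}
      & {in Q, forall x, (lam x == 0%R) = (x \in D)}].
Proof.
move=> nsQP nsDP sDQ idx.
have nDQ : Q \subset 'N(D) := subset_trans (normal_sub nsQP) (normal_norm nsDP).
have cardQD : #|Q / D| = p by rewrite card_quotient.
have cycQD : cyclic (Q / D) by apply: prime_cyclic; rewrite cardQD.
have ZQD : Q / D \subset 'Z(P / D).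
  have pPD : p.-group (P / D) by apply: quotient_pgroup.
  have nsQDP : Q / D <| P / D by apply: quotient_normal.
  have nt : Q / D :&: 'Z(P / D) != 1.
    apply: (meet_center_nil (pgroup_nil pPD) nsQDP).
    by rewrite -cardG_gt1 cardQD prime_gt1.
  by apply: prime_meetG nt; rewrite cardQD.
have /isogP[h injh _] : (Q / D) \isog [set: 'F_p].
  rewrite isog_cyclic_card // cardsT card_Fp // cardQD eqxx andbT.
  by apply: prime_cyclic; rewrite cardsT card_Fp.
have sQN x : x \in Q -> x \in 'N(D) by apply: subsetP.
exists (fun x => h (coset D x)); split=> [x y Qx Qy | x u Qx Pu | x Qx].
- by rewrite morphM ?sQN // morphM ?mem_quotient.
- have Nu := subsetP (normal_norm nsDP) u Pu.
  have Nx := sQN x Qx; rewrite morphJ //; congr (h _); apply/conjg_fixP/commgP.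
  have /centerP[_ cx] := subsetP ZQD _ (mem_quotient D Qx).
  by apply: cx; rewrite mem_quotient.
apply/eqP/idP=> [h0 | Dx]; last by rewrite coset_id // morph1.
apply: coset_idr; first exact: sQN.
by apply: (injmP injh); rewrite ?mem_quotient ?group1 // morph1.
Qed.

Lemma inner_mod_smaller Q : Q <| P -> Q \subset 'Phi(P) -> Q :!=: 1 ->
    (forall R f, F R P f -> inner_mod P Q R f) ->
  exists D : {group gT}, [/\ D <| P, D \proper Q & forall R f, F R P f -> inner_mod P D R f].
Proof.
move=> nsQP sQPhi ntQ innQ.
have pQ : p.-group Q := pgroupS (normal_sub nsQP) pP.
have [_ _ [r cardQ]] := pgroup_pdiv pQ ntQ.
have [|D [sDQ nsDP cardD]] := normal_pgroup (r := r) pP nsQP.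
  by rewrite cardQ pfactorK.
have idx : #|Q : D| = p by rewrite -divgS // cardQ cardD expnS mulnK ?expn_gt0 ?prime_gt0.
have [lam [lamM lamJ lamD]] := central_functional nsQP nsDP sDQ idx.
have lam_st := lam_stable p_pr pP nsQP lamM lamJ sQPhi innQ satF.
exists D; split=> //.
  by rewrite properEcard sDQ cardD cardQ ltn_exp2l ?ltnS ?leqnn ?prime_gt1.
apply: (alperin_inner_mod nsDP satF pP) => R sRP fnR _ a Aa.
apply: (sylow_inner_mod nsDP sRP _ _ _ Aa).
- exact: (satF.1 R sRP fnR).2.
- move=> b x Ab /setIP[Rx Dx]; have Fb := fhom_subr sRP (subxx P) (fisoW (AutF_fiso Ab)).
  have RQx : x \in R :&: Q by rewrite inE Rx (subsetP sDQ).
  have /setIP[_ Qbx] := fhom_memIQ nsQP innQ Fb RQx.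
  by rewrite -lamD // (lam_st _ _ _ Fb RQx) lamD // (subsetP sDQ).
move=> b Ab p'b x Rx; have Fb := fisoW (AutF_fiso Ab).
have FbP := fhom_subr sRP (subxx P) Fb.
have bR y : y \in R -> b y \in R by apply: fhom_mem Fb.
have bkR k y : y \in R -> (b ^+ k) y \in R.
  by elim: k => [|k IHk] Ry; rewrite ?perm1 // expgSr permM bR ?IHk.
have Qbx : x^-1 * b x \in Q.
  have [u Pu bu] := innQ R b FbP.
  (* Modulo Q, b ^+ k is conjugation by u ^+ k. A [k] divisible by |P| and congruent to 1 modulo the
     order of [b] makes u ^+ k trivial and b ^+ k equal to [b]. *)
  have bk k : (x ^ (u ^+ k))^-1 * (b ^+ k) x \in Q.
    elim: k => [|k IHk]; first by rewrite conjg1 perm1 mulVg group1.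
    rewrite !expgSr permM conjgM -[b _](mulKVg (((b ^+ k) x) ^ u)) mulgA.
    rewrite groupM ?bu ?bkR // -conjVg -conjMg.
    by rewrite memJ_norm // (subsetP (normal_norm nsQP)).
  have co : coprime #|P| #[b] by apply: pnat_coprime pP p'b.
  have := bk (chinese #|P| #[b] 0 1).
  rewrite -(expg_mod_order b) chinese_modr // expg_mod_order expg1.
  have dvP : #[u] %| chinese #|P| #[b] 0 1.
    apply: dvdn_trans (order_dvdG Pu) _.
    by rewrite /dvdn chinese_modl // mod0n.
  by rewrite (eqP (_ : u ^+ _ == 1)) ?conjg1 // -order_dvdn.
(* By invariance of [lam], each further application of [b] adds the same value. Taking [k] to be the
   order of [b], which is prime to p, forces that value to be 0. *)
have lamk k : x^-1 * (b ^+ k) x \in Q /\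
    (lam (x^-1 * (b ^+ k) x)%g = lam (x^-1 * b x)%g *+ k)%R.
  elim: k => [|k [Qk lamk]].
    rewrite perm1 mulVg group1; split=> //.
    by apply/eqP; rewrite lamD ?group1.
  have RQk : x^-1 * (b ^+ k) x \in R :&: Q by rewrite inE Qk groupM ?groupV ?bkR.
  have /setIP[_ Qbk] := fhom_memIQ nsQP innQ Fb RQk.
  have -> : x^-1 * (b ^+ k.+1) x = x^-1 * b x * b (x^-1 * (b ^+ k) x).
    by rewrite (fhomM Fb) ?groupV ?bkR // (fhomV Fb) // -mulgA mulKVg expgSr permM.
  by rewrite groupM // lamM // (lam_st _ _ _ FbP RQk) lamk mulrS.
have [_] := lamk #[b]; rewrite expg_order perm1 mulVg => lamb.
rewrite -lamD //; move/eqP: lamb; rewrite eq_sym.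
have /eqP-> : lam 1 == 0%R by rewrite lamD ?group1.
rewrite -mulr_natr mulf_eq0 => /orP[// | ].
rewrite -(dvdn_pcharf (pchar_Fp p_pr)) => p_b.
by have := p'b; rewrite /p_elt p'natE // p_b.
Qed.


Lemma inner_mod_Phi_inner :
    (forall R f, F R P f -> inner_mod P 'Phi(P)%G R f) ->
  forall R f, F R P f -> inner_mod P 1%G R f.
Proof.
move=> innPhi.
suff inn1 n Q : #|Q| <= n -> Q <| P -> Q \subset 'Phi(P) ->
    (forall R f, F R P f -> inner_mod P Q R f) ->
  forall R f, F R P f -> inner_mod P 1%G R f.
  by apply: (inn1 _ _ (leqnn _)) innPhi => //; apply: Phi_normal.
elim: n Q => [|n IHn] Q leQn nsQP sQPhi innQ; first by case: #|Q| (cardG_gt0 Q) leQn.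
have [Q1 | ntQ] := eqVneq Q 1%G; first by rewrite -Q1.
have [D [nsDP prD innD]] := inner_mod_smaller nsQP sQPhi ntQ innQ.
apply: (IHn D) => //; last exact: subset_trans (proper_sub prD) sQPhi.
by rewrite -ltnS; apply: leq_trans (proper_card prD) leQn.
Qed.

End Final.

Theorem theoremB (gT : finGroupType) (p : nat) (P : {group gT})
    (F : fusion_system P) :
  prime p -> (p.-group P)%g -> saturated F p ->
  (fusion_eq F (inner_fusion P) <->
   fusion_eq (norm_fusion F) (inner_fusion P) /\
   strongly_closed F 'Phi(P)%G).
Proof.
move=> p_pr pP satF; split=> [eqF | [eqN clPhi] R S f].
  split=> [R S f | ].
    apply/norm_homP/idP=> [[Ff _] | ]; first by rewrite -eqF.
    move=> innf; have Ff : F R S f by rewrite eqF.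
    case/inner_homP: (innf) => sRP _ _ [a Pa fa]; split=> //.
    have fcj : F P P (conjg^~ a) by apply: fhom_conj; rewrite ?conjGid.
    have cjE x : x \in P -> conj_aut P a x = x ^ a by move=> Px; rewrite conj_autE.
    exists (conj_aut P a); last by move=> x Rx; rewrite fa // cjE // (subsetP sRP).
    by rewrite inE Aut_aut (fhom_ext F P (g := conjg^~ a)).
  split=> [|x f Phix]; first exact: Phi_sub.
  rewrite eqF => /inner_homP[_ _ _ [a Pa fa]].
  by rewrite fa ?cycle_id // memJ_norm // (subsetP (normal_norm (Phi_normal P))).
have innP (a : {perm gT}) : a \in AutF F P ->
  exists2 u, u \in P & {in P, forall x, a x = x ^ u}.
  move=> Aa; have : norm_fusion F P P a.
    by apply/norm_homP; split; [have /setIdP[] := Aa | exists a].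
  by rewrite eqN => /inner_homP[_ _ _].
have inn1 := inner_mod_Phi_inner p_pr pP satF (Phi_inner_mod satF pP clPhi innP).
apply/idP/inner_homP=> [Ff | [sRP sSP fRS [a Pa fa]]].
  have [sRP sSP] := fhom_obj Ff; have [_ _ fRS] := fhom_inj Ff; split=> //.
  have [u Pu fu] := inn1 R f (fhom_subr sSP (subxx P) Ff).
  by exists u => // x Rx; apply/eqP; rewrite eq_sym eq_mulVg1; apply/eqP/set1gP/fu.
rewrite (fhom_ext F S fa); apply: fhom_conj => //.
by have <- : f @: R = R :^ a by apply: eq_in_imset.
Qed.
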